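(* Let $d\in\mathbb{N}$. There exist a sequence of positive integers $(b_n)_{n\ge1}$ and a sequence of estimators $V_n\in\mathcal{H}_{d,b_n}$, where $V_n$ is a function of $X_1,\ldots,X_n\overset{iid}{\sim}p$, such that: (i) (universal consistency) for every $p\in\mathcal{D}_d$, $\|V_n-p\|_1\to 0$ in probability as $n\to\infty$; and (ii) for every $p\in\mathfrak{Q}_d$, $\|V_n-p\|_1\in\widetilde{O}\left(1/\sqrt[3]{n}\right)$, i.e. there exists $q\ge 0$ such that the sequence $\|V_n-p\|_1\,n^{1/3}(\log n)^{-q}$, $n\ge 2$, is bounded in probability.
   Context: $\mathbb{N}$ denotes the positive integers and $[b]=\{1,\ldots,b\}$. $\mathcal{D}_d$ is the set of all probability densities on $[0,1)^d$ (with respect to Lebesgue measure); $\|\cdot\|_1$ is the $L^1$ norm. For $A\in[b]^d$ let $\Lambda_{d,b,A}=\prod_{i=1}^d\left[\frac{A_i-1}{b},\frac{A_i}{b}\right)$ and $h_{d,b,A}=b^d\,\mathbf{1}_{\Lambda_{d,b,A}}$; $\mathcal{H}_{d,b}$ is the convex hull of $\{h_{d,b,A}:A\in[b]^d\}$ (the histograms with $b$ bins per dimension). $\Delta_k$ is the set of vectors in $\mathbb{R}^k$ with nonnegative entries summing to one. For $L\ge0$, $\operatorname{Lip}_L$ is the set of $L$-Lipschitz probability density functions on $[0,1]$. The set of multi-view models with Lipschitz component marginals is $$\mathfrak{Q}_d=\left\{\sum_{i=1}^{k'}w_i\,p_{i,1}\otimes\cdots\otimes p_{i,d}\;:\;k'\in\mathbb{N},\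 w\in\Delta_{k'},\ L'\ge0,\ p_{i,j}\in\operatorname{Lip}_{L'}\right\},$$ where $(p_{i,1}\otimes\cdots\otimes p_{i,d})(x_1,\ldots,x_d)=\prod_{j=1}^d p_{i,j}(x_j)$ (endpoints of the cube are immaterial). Estimators are functions of the sample and do not depend on $p$. A sequence of real random variables $(Z_n)$ is bounded in probability if $\lim_{M\to\infty}\sup_n P(|Z_n|>M)=0$. *)

(* Defs.v *)
From HB Require Import structures.
From mathcomp Require Import all_boot all_order all_algebra finmap.
From mathcomp Require Import all_classical all_reals all_analysis.

Set Implicit Arguments.
Unset Strict Implicit.
Unset Printing Implicit Defensive.

Import Order.TTheory GRing.Theory Num.Theory.
Import numFieldNormedType.Exports.

Local Open Scope classical_set_scope.
Local Open Scope ring_scope.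

Section lebesgue_tuple.
Variable R : realType.

Definition tuple_cons d (xt : R * d.-tuple R) : d.+1.-tuple R :=
  [tuple of xt.1 :: xt.2].

Definition tuple_uncons d (t : d.+1.-tuple R) : R * d.-tuple R :=
  (thead t, [tuple of behead t]).

(* R^d is represented by d.-tuple R, with the product sigma-algebra; the
   Lebesgue measure on R^(d+1) is the image under (x, t) |-> x :: t of the
   product of the Lebesgue measures on R and on R^d. *)
Fixpoint lebesgue_tuple d : set (d.-tuple R) -> \bar R :=
  if d is d'.+1 then
    pushforward (lebesgue_measure \x @lebesgue_tuple d')%E (@tuple_cons d')
  else \d_([tuple] : 0.-tuple R).

Lemma measurable_tuple_cons d : measurable_fun setT (@tuple_cons d).
Proof. exact: measurable_cons. Qed.

Lemma measurable_tuple_uncons d : measurable_fun setT (@tuple_uncons d).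
Proof.
apply/measurable_fun_pairP; split; last exact: measurable_behead.
exact: measurable_tnth.
Qed.

Lemma tuple_unconsK d : cancel (@tuple_uncons d) (@tuple_cons d).
Proof. by move=> t; apply/val_inj; rewrite [in RHS](tuple_eta t). Qed.

Lemma tuple_consK d : cancel (@tuple_cons d) (@tuple_uncons d).
Proof. by move=> [x t]; congr pair; apply/val_inj. Qed.

Section step.
Variables (d : nat) (m : {sigma_finite_measure set (d.-tuple R) -> \bar R}).

Let leb_step : set (d.+1.-tuple R) -> \bar R :=
  pushforward (lebesgue_measure \x m)%E (@tuple_cons d).

Let leb_step0 : leb_step set0 = 0%E.
Proof. by rewrite /leb_step /pushforward preimage_set0 measure0. Qed.

Let leb_step_ge0 A : (0 <= leb_step A)%E.
Proof. by rewrite /leb_step /pushforward. Qed.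

Let leb_step_sigma_additive : semi_sigma_additive leb_step.
Proof.
have mT B : measurable B -> measurable (@tuple_cons d @^-1` B).
  by move=> mB; rewrite -[X in measurable X]setTI; exact: measurable_tuple_cons.
move=> F mF tF mUF; rewrite /leb_step /pushforward preimage_bigcup.
apply: measure_semi_sigma_additive.
- by move=> n; exact: mT.
- apply/trivIsetP => /= i j _ _ ij; rewrite -preimage_setI.
  by move/trivIsetP : tF => /(_ _ _ _ _ ij) ->//; rewrite preimage_set0.
- by rewrite -preimage_bigcup; exact: mT.
Qed.

HB.instance Definition _ := isMeasure.Build _ _ _ leb_step
  leb_step0 leb_step_ge0 leb_step_sigma_additive.

Let leb_step_sigma_finite : sigma_finite setT leb_step.
Proof.
have /sigma_finiteP[F [TF ndF Foo]] :=
  sigma_finiteT (@lebesgue_measure R).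
have /sigma_finiteP[G [TG ndG Goo]] := sigma_finiteT m.
exists (fun n => @tuple_uncons d @^-1` (F n `*` G n)).
  rewrite -preimage_bigcup -(preimage_setT (@tuple_uncons d)); congr (_ @^-1` _).
  apply/seteqP; split=> // -[x y] _.
  have : setT x by [].
  rewrite TF => -[i _ Fix].
  have : setT y by [].
  rewrite TG => -[j _ Gjy].
  exists (maxn i j) => //; split => /=.
  - by move: x Fix; exact/subsetPset/ndF/leq_maxl.
  - by move: y Gjy; exact/subsetPset/ndG/leq_maxr.
move=> k; have [mF Fk] := Foo k; have [mG Gk] := Goo k.
have mFG : measurable (F k `*` G k) by exact: measurableX.
split.
  by rewrite -[X in measurable X]setTI; exact: measurable_tuple_uncons.
rewrite /leb_step /pushforward -comp_preimage.
rewrite (_ : _ \o _ = id); last by apply/funext; exact: tuple_consK.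
by rewrite preimage_id product_measure1E// lte_mul_pinfty// ge0_fin_numE.
Qed.

HB.instance Definition _ := Measure_isSigmaFinite.Build _ _ _ leb_step
  leb_step_sigma_finite.

Lemma sigma_finite_measure_step :
  exists m' : {sigma_finite_measure set (d.+1.-tuple R) -> \bar R},
    m' = pushforward (lebesgue_measure \x m)%E (@tuple_cons d)
      :> (set (d.+1.-tuple R) -> \bar R).
Proof. by exists leb_step. Qed.

End step.

Lemma lebesgue_tuple_sigma_finite_measure d :
  exists m : {sigma_finite_measure set (d.-tuple R) -> \bar R},
    m = @lebesgue_tuple d :> (set (d.-tuple R) -> \bar R).
Proof.
elim: d => [|d [m mE]]; first by exists \d_([tuple] : 0.-tuple R).
by have [m' m'E] := sigma_finite_measure_step m; exists m'; rewrite m'E /= mE.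
Qed.

Let lebesgue_tuple0 d : @lebesgue_tuple d set0 = 0%E.
Proof.
by have [m <-] := lebesgue_tuple_sigma_finite_measure d; rewrite measure0.
Qed.

Let lebesgue_tuple_ge0 d A : (0 <= @lebesgue_tuple d A)%E.
Proof. by have [m <-] := lebesgue_tuple_sigma_finite_measure d. Qed.

Let lebesgue_tuple_sigma_additive d : semi_sigma_additive (@lebesgue_tuple d).
Proof.
have [m <-] := lebesgue_tuple_sigma_finite_measure d.
exact: measure_semi_sigma_additive.
Qed.

HB.instance Definition _ d := isMeasure.Build _ _ _ (@lebesgue_tuple d)
  (@lebesgue_tuple0 d) (@lebesgue_tuple_ge0 d)
  (@lebesgue_tuple_sigma_additive d).

Let lebesgue_tuple_sigma_finite d : sigma_finite setT (@lebesgue_tuple d).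
Proof.
by have [m <-] := lebesgue_tuple_sigma_finite_measure d; exact: sigma_finiteT.
Qed.

HB.instance Definition _ d := Measure_isSigmaFinite.Build _ _ _
  (@lebesgue_tuple d) (@lebesgue_tuple_sigma_finite d).

Lemma lebesgue_tuple_box d (A : 'I_d -> set R) :
  (forall i, measurable (A i)) ->
  lebesgue_tuple [set x : d.-tuple R | forall i, A i (tnth x i)] =
  (\prod_(i < d) lebesgue_measure (A i))%E.
Proof.
elim: d A => [|d IH] A mA.
  rewrite big_ord0 /= diracE mem_set//=; last by case.
rewrite big_ord_recl -IH// -product_measure1E//; last first.
  have -> : [set x : d.-tuple R | forall i, A (lift ord0 i) (tnth x i)] =
      \bigcap_(i in setT) ((fun x => tnth x i) @^-1` A (lift ord0 i)).
    by apply/seteqP; split=> x /= h; [move=> i _; exact: h|move=> i; exact: h].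
  apply: fin_bigcap_measurable => [|i _]; first exact: finite_finset.
  by rewrite -[X in measurable X]setTI; exact: measurable_tnth.
  exact: mA.
rewrite /= /pushforward /=; congr (_ \x _)%E; apply/seteqP; split=> -[x t] /=.
  by move=> h; split=> [|i]; [exact: (h ord0)|
    have := h (lift ord0 i); rewrite tnthS].
move=> [h0 h] i; case: (unliftP ord0 i) => [j|] ->//.
by rewrite tnthS; exact: h.
Qed.

End lebesgue_tuple.
Arguments lebesgue_tuple {R d}.

Section densities.
Variable R : realType.

Definition cube d : set (d.-tuple R) :=
  [set x : d.-tuple R | forall i, tnth x i \in `[0, 1[].

(* Functions on the cube are represented by functions on R^d whose values
   outside of the cube are ignored. *)
Definition density d : set (d.-tuple R -> R) :=
  [set p : d.-tuple R -> R | [/\ measurable_fun (@cube d) p,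
               forall x, cube x -> 0 <= p x &
               (\int[lebesgue_tuple]_(x in @cube d) (p x)%:E = 1)%E]].

Definition L1_norm d (f : d.-tuple R -> R) : R :=
  \int[lebesgue_tuple]_(x in @cube d) `|f x|.

Definition simplex k : set ('I_k -> R) :=
  [set w : 'I_k -> R | (forall i, 0 <= w i) /\ \sum_(i < k) w i = 1].

Definition convex_hull (E : lmodType R) (S : set E) : set E :=
  [set x : E | exists k (w : 'I_k -> R) (s : 'I_k -> E),
    [/\ simplex w, forall i, S (s i) & x = \sum_(i < k) w i *: s i]].

(* The index A i ranges over {0, ..., b - 1} instead of {1, ..., b}. *)
Definition bin d b (A : {ffun 'I_d -> 'I_b}) : set (d.-tuple R) :=
  [set x : d.-tuple R | forall i, tnth x i \in `[(A i)%:R / b%:R, (A i).+1%:R / b%:R[].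

Definition bin_density d b (A : {ffun 'I_d -> 'I_b}) : d.-tuple R -> R :=
  fun x => b%:R ^+ d * \1_(bin A) x.

Definition histogram d b : set (d.-tuple R -> R) :=
  convex_hull (range (@bin_density d b)).

Definition lipschitz_density (L : R) : set (R -> R) :=
  [set f : R -> R | [/\ L.-lipschitz_(`[0, 1]) f,
               forall x, x \in `[0, 1] -> 0 <= f x &
               (\int[lebesgue_measure]_(x in `[0%R, 1%R]) (f x)%:E = 1)%E]].

Definition multiview_density d : set (d.-tuple R -> R) :=
  [set p : d.-tuple R -> R | exists k (w : 'I_k -> R) (L : R) (f : 'I_k -> 'I_d -> R -> R),
    [/\ (0 < k)%N, simplex w, 0 <= L,
        forall i j, lipschitz_density L (f i j) &
        forall x, cube x ->
          p x = \sum_(i < k) w i * \prod_(j < d) f i j (tnth x j)]].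

End densities.

Section random_variables.
Context {R : realType} {disp : measure_display} {T : measurableType disp}.
Variable P : probability T R.

Definition mutually_independent {disp' : measure_display}
    {T' : measurableType disp'} (X : nat -> {RV P >-> T'}) :=
  forall (J : {fset nat}) (A : nat -> set T'),
    (forall i, measurable (A i)) ->
    P (\bigcap_(i in [set` J]) X i @^-1` A i) =
    (\prod_(i <- J) P (X i @^-1` A i))%E.

Definition has_density d (X : {RV P >-> d.-tuple R}) (p : d.-tuple R -> R) :=
  forall A : set (d.-tuple R), measurable A ->
    distribution P X A =
    (\int[lebesgue_tuple]_(x in @cube R d `&` A) (p x)%:E)%E.

Definition iid_sample d (X : nat -> {RV P >-> d.-tuple R})
    (p : d.-tuple R -> R) :=
  mutually_independent X /\ forall i, has_density (X i) p.

Definition cvg_in_probability (Z : nat -> T -> R) (l : R) :=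
  forall e : R, 0 < e -> P [set t | e < `|Z n t - l|] @[n --> \oo] --> 0%E.

Definition bounded_in_probability (Z : nat -> T -> R) :=
  ereal_sup [set P [set t | M < `|Z n t|] | n in [set: nat]] @[M --> +oo]
    --> 0%E.

End random_variables.

(* An estimator based on n observations; since its values are histograms,
   measurability at each point is that of the weights of the histogram. *)
Definition histogram_estimator (R : realType) d b n
    (V : n.-tuple (d.-tuple R) -> d.-tuple R -> R) :=
  (forall s, histogram b (V s)) /\ (forall x, measurable_fun setT (V ^~ x)).

(* Main.v *)
Require Import Defs.
From HB Require Import structures.
From mathcomp Require Import all_boot all_order all_algebra finmap.
From mathcomp Require Import ring lra zify.
From mathcomp Require Import all_classical all_reals all_analysis measurable_realfun.

Set Implicit Arguments.
Unset Strict Implicit.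
Unset Printing Implicit Defensive.

Import Order.TTheory GRing.Theory Num.Theory.
Import numFieldNormedType.Exports.

Local Open Scope classical_set_scope.
Local Open Scope ring_scope.

(** The estimator is a minimum distance estimator over a finite set of
candidates. With about n^(1/3) bins per dimension, a candidate is a
normalised tensor sum_(i < k) prod_(j < d) u_ij, where the u_ij are vectors
on the bins with entries on a finite grid and where the rank k grows like
log n. There are only exp(O(k d b log b)) candidates, so that the complexity
of the class is driven by b = n^(1/3) up to logarithms, and not by b^d.

Among the candidates the estimator selects one whose masses are closest to
the empirical masses on all Yatracos sets {w1 > w2} of two candidates. On
histograms the L1 distance is twice the largest difference of masses, attained
on a Yatracos set; hence (min_distanceP, estimator_error) the L1 error is at
most 5 a + 4 D, where a is the error of the best candidate and D the largest
deviation of the empirical masses. Hoeffding's inequality and a union bound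
over the pairs of candidates (estimator_tail) show that D is of order
sqrt(k b log n / n), that is n^(-1/3) log n (estimator_deviation). Only the
bins of the observations matter, so that all of this takes place in the finite
product space of the n-tuples of bins.

It remains to bound a. A multi-view density with Lipschitz marginals is a sum
of k0 products of Lipschitz functions; reading these functions at the grid
points costs O(1/b), and rounding their values to the grid costs O(k/b)
(multiview_candidate). This gives the rate. For an arbitrary density, dyadic
step functions are dense in L1 (step_density), and a step function at a fixed
dyadic resolution is exactly a tensor of fixed rank at every finer dyadic
resolution, so that it is eventually among the candidates up to rounding
(universal_candidate). For this the numbers of bins are powers of two. *)

(** * Minimum distance selection among finitely many candidates *)

Section minimum_distance.
Variables (R : realType) (Theta Omega : finType).

(** Both functions have the same mass, so that the positive and the negative part
of their difference have the same mass; the positive part lives on the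
Yatracos set of the pair. *)
Lemma sum_norm_subr (v f : Omega -> R) : \sum_A v A = \sum_A f A ->
  \sum_A `|v A - f A| = 2 * \sum_(A | f A < v A) (v A - f A).
Proof.
move=> vf; have h0 : \sum_A (v A - f A) = 0 by rewrite sumrB vf subrr.
suff <- : \sum_A `|v A - f A| + \sum_A (v A - f A) =
    2 * \sum_(A | f A < v A) (v A - f A) by rewrite h0 addr0.
rewrite [in RHS]big_mkcond mulr_sumr -big_split; apply: eq_bigr => A _ /=.
case: ltP => h; first by rewrite gtr0_norm ?subr_gt0//; ring.
by rewrite ler0_norm ?subr_le0// mulr0 addNr.
Qed.

Variable w : Theta -> Omega -> R.

Definition yatracos_dist (th : Theta) (q : Omega -> R) : R :=
  \big[Num.max/0]_(p : Theta * Theta)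
    `|\sum_(A | w p.2 A < w p.1 A) (w th A - q A)|.

Definition min_distance (th0 : Theta) (q : Omega -> R) : Theta :=
  [arg min_(th < th0) yatracos_dist th q]%O.

(** The selected candidate is compared with th on their own Yatracos set: the
empirical masses are within D + a of those of th, hence also of those of the
selected candidate, by minimality. *)
Lemma min_distanceP th0 th (qhat q : Omega -> R) (D a : R) :
  (forall th, \sum_A w th A = 1) ->
  (forall p : Theta * Theta,
    `|\sum_(A | w p.2 A < w p.1 A) (qhat A - q A)| <= D) ->
  (forall E : pred Omega, `|\sum_(A | E A) (w th A - q A)| <= a) ->
  \sum_A `|w (min_distance th0 qhat) A - w th A| <= 4 * D + 4 * a.
Proof.
move=> w1 HD Ha; set v := min_distance th0 qhat.
rewrite sum_norm_subr ?w1//.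
have vth : yatracos_dist v qhat <= yatracos_dist th qhat.
  by rewrite /v /min_distance; case: arg_minP => // i _ /(_ th); apply.
have D0 : 0 <= D by apply: le_trans (HD (th, th)); exact: normr_ge0.
have a0 : 0 <= a by apply: le_trans (Ha xpred0); exact: normr_ge0.
have thDa : yatracos_dist th qhat <= D + a.
  apply: bigmax_le => [|[t1 t2] _] /=; first exact: addr_ge0.
  rewrite (eq_bigr (fun A => (w th A - q A) - (qhat A - q A))); last by move=> A _; ring.
  rewrite sumrB [leRHS]addrC (le_trans (ler_normB _ _))// lerD//; exact: (HD (t1, t2)).
rewrite (eq_bigr (fun A => (w v A - qhat A) - (w th A - qhat A))); last first.
  by move=> A _; rewrite opprB addrA subrK.
rewrite sumrB.
have h1 := le_trans (le_bigmax 0 (fun p : Theta * Theta =>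
   `|\sum_(A | w p.2 A < w p.1 A) (w v A - qhat A)|) (v, th)) vth.
have h2 := (le_bigmax 0 (fun p : Theta * Theta =>
   `|\sum_(A | w p.2 A < w p.1 A) (w th A - qhat A)|) (v, th)).
have {h1} /= h1 := le_trans h1 thDa.
have {h2} /= h2 := le_trans h2 thDa.
by move: h1 h2; rewrite !ler_norml => /andP[? ?] /andP[? ?]; lra.
Qed.

End minimum_distance.

(** * Hoeffding's inequality on a finite product space *)

Section hoeffding.
Variables (R : realType) (Omega : finType) (q : Omega -> R).
Hypotheses (q0 : forall A, 0 <= q A) (q1 : \sum_A q A = 1).

(** From exp(- x) >= 1 - x and (1 - x) (1 + x + 2 x^2) >= 1. *)
Lemma expR_le_quadratic (x : R) : x <= 2^-1 -> expR x <= 1 + x + 2 * x ^+ 2.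
Proof.
move=> x2; have h := expR_ge1Dx (- x).
rewrite expRN in h; have e0 := expR_gt0 x.
have hx : (1 - x) * expR x <= 1.
  by rewrite -ler_pdivlMr ?mul1r.
have x1 : 0 < 1 - x by lra.
have h1 : expR x <= (1 - x)^-1 by rewrite -[leRHS]mul1r ler_pdivlMr// mulrC.
apply: le_trans h1 _.
rewrite -[leLHS]mul1r ler_pdivrMr//.
have := sqr_ge0 x; rewrite !expr2; nra.
Qed.

Lemma mgf_le_expR (f : Omega -> R) (l : R) :
  `|l| <= 2^-1 -> (forall A, `|f A| <= 1) -> \sum_A q A * f A = 0 ->
  \sum_A q A * expR (l * f A) <= expR (2 * l ^+ 2).
Proof.
move=> l2 f1 f0; apply: le_trans (expR_ge1Dx _).
have -> : 1 + 2 * l ^+ 2 =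
    \sum_A (q A * (1 + 2 * l ^+ 2) + l * (q A * f A)).
  by rewrite big_split /= -mulr_suml q1 -mulr_sumr f0; ring.
apply: ler_sum => A _; rewrite (mulrCA l) -mulrDr ler_wpM2l//.
have lf : `|l * f A| <= `|l| by rewrite normrM ler_piMr.
apply: (le_trans (expR_le_quadratic _)).
  by apply: le_trans (ler_norm _) _; apply: le_trans lf _.
rewrite -addrA [l * f A + _]addrC addrA lerD2r lerD2l ler_pM2l//.
by rewrite -(ger0_norm (sqr_ge0 (l * f A))) -(ger0_norm (sqr_ge0 l)) !normrX lerXn2r ?nnegrE.
Qed.

(** Markov's inequality for exp(l * sum), with l = t / 4; the exponential moment
factorises over the product space. *)
Lemma chernoff n (f : Omega -> R) (t : R) :
  0 < t <= 2 -> (forall A, `|f A| <= 1) -> \sum_A q A * f A = 0 ->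
  \sum_(j : {ffun 'I_n -> Omega} | n%:R * t <= \sum_i f (j i)) \prod_i q (j i)
  <= expR (- (n%:R * t ^+ 2 / 8)).
Proof.
move=> /andP[t0 t2] f1 f0; pose l := t / 4.
apply: (@le_trans _ _ (\sum_(j : {ffun 'I_n -> Omega})
    (\prod_i (q (j i) * expR (l * f (j i)))) * expR (- (l * (n%:R * t))))).
  rewrite big_mkcond; apply: ler_sum => j _; case: ifPn => h; last first.
    rewrite mulr_ge0 ?expR_ge0// prodr_ge0// => i _.
    by rewrite mulr_ge0 ?expR_ge0.
  rewrite big_split /= -expR_sum -mulrA -expRD ler_peMr//.
    by rewrite prodr_ge0.
  rewrite -[leLHS]expR0 ler_expR -mulr_sumr -mulrBr mulr_ge0 ?subr_ge0//.
  by rewrite /l divr_ge0// ltW.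
rewrite -mulr_suml -(bigA_distr_bigA (fun (i : 'I_n) A => q A * expR (l * f A))).
rewrite prodr_const card_ord.
apply: (@le_trans _ _ (expR (2 * l ^+ 2) ^+ n * expR (- (l * (n%:R * t))))).
  rewrite ler_wpM2r ?expR_ge0// lerXn2r ?nnegrE ?expR_ge0//.
    by apply: sumr_ge0 => A _; rewrite mulr_ge0 ?expR_ge0.
  apply: mgf_le_expR => //; rewrite ger0_norm /l ?divr_ge0 ?(ltW t0)//; lra.
rewrite -expRM_natl -expRD ler_expR /l -subr_ge0 le_eqVlt; apply/orP; left.
by apply/eqP; field.
Qed.

Definition empirical n (j : {ffun 'I_n -> Omega}) (A : Omega) : R :=
  (\sum_i (j i == A)%:R) / n%:R.

(** Two applications of the Chernoff bound to the centred indicator of E. For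
t > 2 the event is empty, which removes the upper bound on t. *)
Lemma hoeffding n (E : pred Omega) (t : R) : (0 < n)%N -> 0 < t ->
  \sum_(j : {ffun 'I_n -> Omega} |
      t < `|\sum_(A | E A) (empirical j A - q A)|) \prod_i q (j i)
  <= 2 * expR (- (n%:R * t ^+ 2 / 8)).
Proof.
move=> n0 t0; have n0' : 0 < n%:R :> R by rewrite ltr0n.
pose f A := (E A)%:R - \sum_(A' | E A') q A'.
have qE0 : 0 <= \sum_(A | E A) q A by rewrite sumr_ge0.
have qE1 : \sum_(A | E A) q A <= 1.
  by rewrite -q1 [leRHS](bigID E)/= lerDl sumr_ge0.
have f1 A : `|f A| <= 1.
  rewrite /f ler_norml; move: qE0 qE1; set s := (\sum_(A | E A) q A) => s0 s1.
  by case: (E A) => /=; rewrite ?mulr1n ?mulr0n; apply/andP; split; lra.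
have f0 : \sum_A q A * f A = 0.
  under eq_bigr do rewrite mulrBr.
  rewrite sumrB -mulr_suml q1 mul1r [X in _ - X]big_mkcond /=.
  by apply/eqP; rewrite subr_eq0; apply/eqP; apply: eq_bigr => A _; case: (E A); rewrite ?mulr1 ?mulr0.
have fE (j : {ffun 'I_n -> Omega}) :
    \sum_(A | E A) (empirical j A - q A) = (\sum_i f (j i)) / n%:R.
  rewrite !sumrB /empirical -mulr_suml sumr_const card_ord mulrBl.
  rewrite -(mulr_natr (\sum_(A | E A) q A)) mulfK ?gt_eqF//; congr (_ / _ - _).
  rewrite exchange_big; apply: eq_bigr => i _ /=.
  rewrite big_mkcond (bigD1 (j i))//= eqxx big1 ?addr0; first by case: ifP.
  by move=> A /negbTE; rewrite eq_sym => ->; case: ifP.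
have [t2|t2] := leP t 2; last first.
  rewrite big_pred0 ?mulr_ge0 ?expR_ge0// => j; apply/negbTE; rewrite -leNgt fE.
  rewrite normrM normfV (gtr0_norm n0') ler_pdivrMr//.
  apply: le_trans (ler_norm_sum _ _ _) _.
  apply: (@le_trans _ _ (\sum_(i < n) 1)); first by apply: ler_sum => i _; exact: f1.
  by rewrite sumr_const card_ord -mulr_natl mulr1 ler_peMl ?ltW//; lra.
have tt : 0 < t <= 2 by rewrite t0.
have C1 := chernoff n tt f1 f0.
have f1' A : `|- f A| <= 1 by rewrite normrN.
have f0' : \sum_A q A * - f A = 0.
  by under eq_bigr do rewrite mulrN; rewrite sumrN f0 oppr0.
have C2 := chernoff n tt f1' f0'.
rewrite mulr_natl mulr2n; apply: le_trans (lerD C1 C2).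
rewrite [leLHS]big_mkcond [X in _ <= X + _]big_mkcond [X in _ <= _ + X]big_mkcond.
rewrite -big_split; apply: ler_sum => j _ /=.
have p0 : 0 <= \prod_i q (j i) by rewrite prodr_ge0.
rewrite fE sumrN normrM normfV (gtr0_norm n0') ltr_pdivlMr// mulrC.
case: ifPn => [|_]; last by do 2 case: ifP => _; rewrite ?addr0 ?add0r ?addr_ge0.
by rewrite ltr_normr => /orP[] h; rewrite (ltW h) ?lerDl ?lerDr; case: ifP.
Qed.

End hoeffding.

(** * Tensors with entries on a finite grid *)

Section tensors.
Variable R : realType.

(** Telescoping, one factor at a time; the constant is crude. *)
Lemma prodr_diff_le n (M delta : R) (u v : 'I_n -> R) :
  1 <= M -> (forall j, 0 <= u j <= M) -> (forall j, 0 <= v j <= M) ->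
  (forall j, `|u j - v j| <= delta) ->
  `|\prod_j u j - \prod_j v j| <= n%:R * M ^+ n * delta.
Proof.
move=> M1; elim: n u v => [|n IH] u v hu hv huv.
  by rewrite !big_ord0 subrr normr0 !mul0r.
have M0 : 0 <= M by exact: le_trans M1.
have d0 : 0 <= delta by apply: le_trans (huv ord0).
rewrite !big_ord_recl.
set U := \prod_(i < n) u _; set V := \prod_(i < n) v _.
have -> : u ord0 * U - v ord0 * V = u ord0 * (U - V) + (u ord0 - v ord0) * V by ring.
have hUV : `|U - V| <= n%:R * M ^+ n * delta by apply: IH.
have V0 : 0 <= V by apply: prodr_ge0 => i _; case/andP: (hv (lift ord0 i)).
have VM : V <= M ^+ n.
  by rewrite -[in leRHS](card_ord n) -prodr_const; apply: ler_prod => i _; exact: hv.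
have /andP[u0 uM] := hu ord0.
apply: (le_trans (ler_normD _ _)); rewrite !normrM (ger0_norm u0) (ger0_norm V0).
have -> : n.+1%:R * M ^+ n.+1 * delta =
   M * (n%:R * M ^+ n * delta) + delta * M ^+ n.+1 by rewrite -natr1 exprS; ring.
apply: lerD; first exact: ler_pM.
apply: ler_pM => //; apply: le_trans VM _.
by rewrite exprS ler_peMl// exprn_ge0.
Qed.

Section normalize.
Variable Omega : finType.

(** When the total mass vanishes the uniform weights are used, so that the result
is always a probability vector. *)
Definition normalize (t : Omega -> R) (A : Omega) : R :=
  if \sum_A t A == 0 then #|Omega|%:R^-1 else t A / \sum_A t A.

Lemma normalize_ge0 t A : (forall A, 0 <= t A) -> 0 <= normalize t A.
Proof.
move=> t0; rewrite /normalize; case: ifP => _; first by rewrite invr_ge0.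
by rewrite divr_ge0// sumr_ge0.
Qed.

Lemma sum_normalize t : (0 < #|Omega|)%N -> \sum_A normalize t A = 1.
Proof.
move=> O0; rewrite /normalize; case: (eqVneq (\sum_A t A) 0) => [_|S0]; last first.
  by rewrite -mulr_suml mulfV.
by rewrite sumr_const -[LHS]mulr_natr mulVf// pnatr_eq0 -lt0n.
Qed.

End normalize.

Variables (d b k : nat).

(** With b + 1 bins the entries of the factors are multiples of 1 / (b + 1)
between 0 and b + 1: both the step and the range improve with b, so that
any bounded function is eventually rounded with error 1 / (b + 1). *)
Definition tensor_param := {ffun 'I_k * 'I_d * 'I_b.+1 -> 'I_(b.+1 * b.+1).+1}.

Definition tensor (th : tensor_param) (A : {ffun 'I_d -> 'I_b.+1}) : R :=
  \sum_(i < k) \prod_(j < d) ((th (i, j, A j))%:R / b.+1%:R).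

Lemma tensor_ge0 th A : 0 <= tensor th A.
Proof. by apply: sumr_ge0 => i _; apply: prodr_ge0 => j _; rewrite divr_ge0. Qed.

Lemma card_tensor_param : #|tensor_param| = ((b.+1 * b.+1).+1 ^ (k * d * b.+1))%N.
Proof. by rewrite card_ffun !card_prod !card_ord. Qed.

Lemma round_tensor (g : 'I_k -> 'I_d -> 'I_b.+1 -> R) (M : R) :
  1 <= M -> M <= b.+1%:R -> (forall i j a, 0 <= g i j a <= M) ->
  exists th, forall A : {ffun 'I_d -> 'I_b.+1}, `|\sum_i \prod_j g i j (A j) - tensor th A| <=
     k%:R * (d%:R * M ^+ d) / b.+1%:R.
Proof.
move=> M1 Mb hg; have b0 : 0 < b.+1%:R :> R by rewrite ltr0n.
exists [ffun x : 'I_k * 'I_d * 'I_b.+1 =>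
  inord (Num.truncn (b.+1%:R * g x.1.1 x.1.2 x.2))].
move=> A; rewrite /tensor -sumrB; apply: le_trans (ler_norm_sum _ _ _) _.
rewrite -mulrA mulr_natl -[k in leRHS]card_ord -sumr_const; apply: ler_sum => i _.
apply: prodr_diff_le => // j; rewrite ffunE /=; set x := g _ _ _.
all: have /andP[x0 xM] : 0 <= x <= M := hg i j (A j).
all: have bx0 : 0 <= b.+1%:R * x by rewrite mulr_ge0// ltW.
all: have /andP[t1 t2] := truncn_itv bx0.
all: rewrite inordK; last by
  rewrite ltnS -(ler_nat R) (le_trans t1)// natrM ler_pM2l// (le_trans xM).
- by rewrite divr_ge0//= ler_pdivrMr// (le_trans t1)// mulrC ler_pM2r.
- set t := Num.truncn _ in t1 t2 *.
  have -> : x - t%:R / b.+1%:R = (b.+1%:R * x - t%:R) / b.+1%:R.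
    by rewrite mulrBl mulrAC mulfV ?mul1r// lt0r_neq0.
  rewrite normrM normfV (gtr0_norm b0) ler_piMl ?invr_ge0 ?(ltW b0)//.
  by rewrite ger0_norm ?subr_ge0// lerBlDr addrC natr1 ltW.
Qed.

(** Smaller ranks are padded with vanishing factors; a product of vanishing
factors vanishes because d > 0. *)
Lemma approx_tensor (I : finType) (g : I -> 'I_d -> 'I_b.+1 -> R) (M : R) :
  (0 < d)%N -> (#|I| <= k)%N ->
  1 <= M -> M <= b.+1%:R -> (forall i j a, 0 <= g i j a <= M) ->
  exists th, forall A : {ffun 'I_d -> 'I_b.+1}, `|\sum_i \prod_j g i j (A j) - tensor th A| <=
     k%:R * (d%:R * M ^+ d) / b.+1%:R.
Proof.
move=> d0 Ik M1 Mb hg.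
pose g' (n : nat) j a := oapp (fun o : 'I_#|I| => g (enum_val o) j a) 0 (insub n).
have hg' (i : 'I_k) j a : 0 <= g' i j a <= M.
  by rewrite /g'; case: (insub _) => [s | ] /=; rewrite ?hg ?lexx ?(le_trans _ M1).
have [th Hth] := round_tensor M1 Mb hg'; exists th => A.
apply: le_trans (Hth A); rewrite le_eqVlt; apply/orP; left; apply/eqP.
congr (`|_ - _|); rewrite big_enum_val /=.
transitivity (\sum_(i < #|I|) \prod_j g' i j (A j)).
  apply: eq_bigr => i _; apply: eq_bigr => j _; rewrite /g'.
  by rewrite valK.
rewrite (big_ord_widen k (fun n => \prod_j g' n j (A j)))// big_mkcond.
apply: eq_bigr => i _; case: ifPn => // iI.
rewrite (bigD1 (Ordinal d0))//= /g' insubN//= mul0r.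
by [].
Qed.

End tensors.

(** * Bins of the cube and integrals of functions constant on bins *)

Section cells.
Variables (R : realType) (d : nat).
Local Notation mu := (@lebesgue_tuple R d).
Local Notation cube := (@cube R d).

Lemma measurable_tuple_box (A : 'I_d -> set R) : (forall i, measurable (A i)) ->
  measurable [set x : d.-tuple R | forall i, A i (tnth x i)].
Proof.
move=> mA.
have -> : [set x : d.-tuple R | forall i, A i (tnth x i)] =
    \bigcap_(i in setT) ((fun x => tnth x i) @^-1` A i).
  by apply/seteqP; split=> x /= h; [move=> i _; exact: h|move=> i; exact: h].
apply: fin_bigcap_measurable => [|i _]; first exact: finite_finset.
by rewrite -[X in measurable X]setTI; exact: measurable_tnth.
Qed.

Lemma measurable_cube : measurable cube.
Proof. exact: (@measurable_tuple_box (fun=> `[0, 1[%classic)). Qed.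

Lemma measure_cube : mu cube = 1%E.
Proof.
rewrite [LHS](@lebesgue_tuple_box _ _ (fun=> `[0, 1[%classic))//.
by rewrite big1// => i _; rewrite lebesgue_measure_itv/= lte_fin ltr01 oppr0 adde0.
Qed.

Lemma measurable_preimage_truncn (c : R) (S : set nat) :
  measurable [set x : R | S (Num.truncn (c * x))].
Proof.
have -> : [set x : R | S (Num.truncn (c * x))] =
    (fun x => c * x) @^-1` \bigcup_(n in S) (Num.truncn @^-1` [set n]).
  by apply/seteqP; split=> x /=; [move=> h; exists (Num.truncn (c * x))|case=> n Sn /= ->].
rewrite -[X in measurable X]setTI; apply: (mulrl_measurable c) => //.
apply: bigcup_measurable => n _.
have -> : Num.truncn @^-1` [set n] =
   `]-oo, n.+1%:R[%classic `\` [set x : R | (Num.truncn x < n)%N].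
  apply/seteqP; split=> x /=; rewrite in_itv/= -truncn_le_nat.
    by move=> ->; rewrite ltnn leqnn.
  by move=> [h1 /negP]; rewrite -leqNgt => h2; apply/eqP; rewrite eqn_leq h1 h2.
apply: measurableD => //; case: n => [|n].
  by rewrite [X in measurable X](_ : _ = set0)//; apply/seteqP; split.
rewrite [X in measurable X](_ : _ = `]-oo, n.+1%:R[%classic)//.
by apply/seteqP; split=> x /=; rewrite in_itv/= ltnS truncn_le_nat.
Qed.

Section fixed_resolution.
Variable b : nat.
Local Notation Omega := {ffun 'I_d -> 'I_b.+1}.

(** Out-of-range coordinates are sent to the index 0, which makes this a total
function with values in a finite type. *)
Definition cell (x : d.-tuple R) : Omega :=
  [ffun i => inord (Num.truncn (b.+1%:R * tnth x i))].

Lemma measurable_cell (S : set Omega) : measurable (cell @^-1` S).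
Proof.
have -> : cell @^-1` S = \bigcup_(A in S) [set x | forall i,
    [set y | inord (Num.truncn (b.+1%:R * y)) = A i] (tnth x i)].
  apply/seteqP; split => x /= => [h|[A SA /= h]].
    by exists (cell x) => //= i; rewrite ffunE.
  by rewrite (_ : cell x = A)//; apply/ffunP => i; rewrite ffunE h.
apply: fin_bigcup_measurable => [|A _]; first exact: finite_finset.
apply: (@measurable_tuple_box (fun i => [set y | inord (Num.truncn (b.+1%:R * y)) = A i])).
move=> i; exact: (measurable_preimage_truncn b.+1%:R [set n | inord n = A i]).
Qed.

Lemma measurable_fun_cell (c : Omega -> R) (D : set _) :
  measurable_fun D (fun x => c (cell x)).
Proof.
move=> mD Y mY; apply: measurableI => //.
exact: (measurable_cell (c @^-1` Y)).
Qed.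

Lemma cell_val x i : cube x -> cell x i = Num.truncn (b.+1%:R * tnth x i) :> nat.
Proof.
move=> /(_ i); rewrite in_itv /= => /andP[x0 x1]; rewrite ffunE inordK//.
by rewrite truncn_lt_nat ?mulr_ge0//; rewrite -[ltRHS]mulr1 ltr_pM2l// ltr0n.
Qed.

Lemma cell_itv x i : cube x ->
  (cell x i)%:R / b.+1%:R <= tnth x i < (cell x i).+1%:R / b.+1%:R.
Proof.
move=> cx; have b0 : 0 < b.+1%:R :> R by rewrite ltr0n.
rewrite ler_pdivrMr// ltr_pdivlMr// cell_val// mulrC truncn_itv//.
by move: (cx i); rewrite in_itv /= => /andP[x0 x1]; rewrite mulr_ge0// ltW.
Qed.

Lemma bin_subset_cube (A : Omega) : bin A `<=` cube.
Proof.
move=> x /= xA i; have := xA i; rewrite !in_itv/= => /andP[h1 h2].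
rewrite (le_trans _ h1) ?divr_ge0//= (lt_le_trans h2)//.
by rewrite ler_pdivrMr ?ltr0n// mul1r ler_nat ltn_ord.
Qed.

Lemma cell_bin (A : Omega) : bin A = cube `&` cell @^-1` [set A].
Proof.
apply/seteqP; split => [x xA|x [cx /= <-] i]; last first.
  by rewrite in_itv/= cell_itv.
have cx := bin_subset_cube xA; split => //=; apply/ffunP => i; apply/val_inj => /=.
rewrite cell_val//; apply: truncn_def.
by move: (xA i); rewrite in_itv/= ler_pdivrMr ?ltr0n// ltr_pdivlMr ?ltr0n// mulrC.
Qed.

Lemma bin_densityE (A : Omega) x : cube x ->
  bin_density A x = b.+1%:R ^+ d * (A == cell x)%:R.
Proof.
move=> cx; rewrite /bin_density indicE cell_bin; congr (_ * _%:R).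
rewrite in_setI mem_set//=; case: eqP => [->|h]; first by rewrite mem_set.
by rewrite memNset//= => /esym.
Qed.

Lemma measure_bin (A : Omega) : mu (bin A) = ((b.+1%:R ^+ d)^-1)%:E.
Proof.
rewrite [LHS](@lebesgue_tuple_box _ _ (fun i =>
   `[(A i)%:R / b.+1%:R, (A i).+1%:R / b.+1%:R[%classic))//.
rewrite (eq_bigr (fun=> (b.+1%:R^-1)%:E)); last first.
  move=> i _; rewrite lebesgue_measure_itv/= lte_fin ltr_pM2r ?invr_gt0 ?ltr0n//.
  by rewrite ltr_nat ltnSn -EFinB -mulrBl -natr1 addrC addKr mul1r.
by rewrite prodEFin prodr_const card_ord exprVn.
Qed.

Lemma integrable_cell (c : Omega -> R) : mu.-integrable cube (EFin \o (c \o cell)).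
Proof.
apply: measurable_bounded_integrable.
- exact: measurable_cube.
- by rewrite /= measure_cube ltry.
- exact: measurable_fun_cell.
- exists (\sum_A `|c A|); split; first by rewrite num_real.
  move=> M hM x _ /=; apply/ltW; apply: le_lt_trans hM.
  by rewrite (bigD1 (cell x))//= lerDl sumr_ge0.
Qed.

Lemma Rintegral_cell (c : Omega -> R) (E : pred Omega) :
  \int[mu]_(x in cube `&` (cell @^-1` [set A | E A])) c (cell x)
  = \sum_(A | E A) c A / b.+1%:R ^+ d.
Proof.
rewrite /Rintegral.
have -> : cube `&` cell @^-1` [set A | E A] =
    \big[setU/set0]_(A <- enum E) bin A.
  rewrite -bigcup_seq; apply/seteqP; split=> [x [cx xE]|x [A /=]].
    exists (cell x) => /=; first by rewrite mem_enum.
    by rewrite cell_bin; split.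
  by rewrite mem_enum cell_bin => EA [cx /= ->]; split.
have mbin (A : Omega) : measurable (bin A : set (d.-tuple R)).
  by rewrite cell_bin; apply: measurableI; [exact: measurable_cube|exact: measurable_cell].
rewrite integral_bigsetU_EFin//=.
- rewrite big_enum /=.
  rewrite (eq_bigr (fun A => (c A / b.+1%:R ^+ d)%:E)); first by rewrite sumEFin.
  move=> A _; rewrite (eq_integral (cst (c A)%:E)); last first.
    by move=> x; rewrite inE cell_bin => -[_ /= ->].
  rewrite integral_cst// EFinM; congr (_ * _)%E; exact: measure_bin.
- exact: enum_uniq.
- move=> A B _ _ [x]; rewrite !cell_bin => -[[_ /= <-] [_ <-]]//.
- by apply/measurable_EFinP; exact: measurable_fun_cell.
Qed.

Lemma Rintegral_cellT (c : Omega -> R) :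
  \int[mu]_(x in cube) c (cell x) = \sum_A c A / b.+1%:R ^+ d.
Proof.
rewrite -(Rintegral_cell c xpredT); congr (Rintegral _ _ _).
by apply/seteqP; split => // x [].
Qed.

Lemma L1_norm_cell (c : Omega -> R) (f : d.-tuple R -> R) :
  (forall x, cube x -> f x = c (cell x)) ->
  L1_norm f = \sum_A `|c A| / b.+1%:R ^+ d.
Proof.
move=> fc; rewrite -Rintegral_cellT; apply: eq_Rintegral => x; rewrite inE => cx.
by rewrite fc.
Qed.

End fixed_resolution.
End cells.

(** * The L1 norm on the cube *)

Section L1.
Variables (R : realType) (d : nat).
Local Notation mu := (@lebesgue_tuple R d).
Local Notation cube := (@cube R d).
Local Notation integrable f := (mu.-integrable cube (EFin \o f)).

Lemma integrableB_cube (f g : d.-tuple R -> R) :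
  integrable f -> integrable g -> integrable (f \- g).
Proof. by move=> hf hg; have := integrableB (@measurable_cube R d) hf hg. Qed.

Lemma integrableD_cube (f g : d.-tuple R -> R) :
  integrable f -> integrable g -> integrable (f \+ g).
Proof. by move=> hf hg; have := integrableD (@measurable_cube R d) hf hg. Qed.

Lemma le_L1_norm (f g : d.-tuple R -> R) : integrable f -> integrable g ->
  (forall x, cube x -> `|f x| <= g x) -> L1_norm f <= \int[mu]_(x in cube) g x.
Proof.
move=> hf hg fg; apply: le_Rintegral => //; first exact: measurable_cube.
exact: integrable_norm.
Qed.

Lemma L1_norm_ge0 (f : d.-tuple R -> R) : 0 <= L1_norm f.
Proof. by apply: Rintegral_ge0. Qed.

Lemma L1_normD (f g : d.-tuple R -> R) : integrable f -> integrable g ->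
  L1_norm (f \+ g) <= L1_norm f + L1_norm g.
Proof.
move=> hf hg; rewrite -RintegralD//=; [|exact: measurable_cube|exact: integrable_norm..].
apply: le_L1_norm; first exact: integrableD_cube.
  by apply: (integrableD_cube (f := Num.norm \o f) (g := Num.norm \o g)); exact: integrable_norm.
by move=> x _; exact: ler_normD.
Qed.

Lemma L1_norm_triangle (g f h : d.-tuple R -> R) :
  integrable f -> integrable g -> integrable h ->
  L1_norm (f \- h) <= L1_norm (f \- g) + L1_norm (g \- h).
Proof.
move=> hf hg hh; apply: le_trans (L1_normD _ _); last 2 first.
- exact: integrableB_cube.
- exact: integrableB_cube.
rewrite (_ : f \- h = (f \- g) \+ (g \- h))//.
by apply/funext => x /=; rewrite addrA subrK.
Qed.

Lemma L1_normBC (f g : d.-tuple R -> R) : L1_norm (f \- g) = L1_norm (g \- f).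
Proof. by apply: eq_Rintegral => x _ /=; rewrite distrC. Qed.

Lemma density_integrable (p : d.-tuple R -> R) : density p -> integrable p.
Proof.
move=> [mp p0 p1]; apply/integrableP; split; first exact/measurable_EFinP.
rewrite (eq_integral (EFin \o p)) ?p1 ?ltry// => x; rewrite inE => cx /=.
by rewrite ger0_norm ?p0.
Qed.

Lemma L1_norm_density (p : d.-tuple R -> R) : density p -> L1_norm p = 1.
Proof.
move=> [mp p0 p1]; rewrite /L1_norm /Rintegral (eq_integral (EFin \o p)) ?p1//.
by move=> x; rewrite inE => cx /=; rewrite ger0_norm ?p0.
Qed.

End L1.

(** * Density of dyadic step functions *)

Section dyadic.
Variables (R : realType) (d : nat).
Local Notation mu := (@lebesgue_tuple R d).
Local Notation cube := (@cube R d).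
Local Notation integrable f := (mu.-integrable cube (EFin \o f)).

(** The bins are indexed by ordinals below a syntactic successor, hence the form
(2 ^ m).-1 for the resolutions below. *)
Lemma dyadic_pred_succ m : (2 ^ m).-1.+1 = (2 ^ m)%N.
Proof. by rewrite prednK// expn_gt0. Qed.

Lemma dyadic_cell_itv m (x : d.-tuple R) i : cube x ->
  (cell (2 ^ m).-1 x i)%:R <= (2 ^ m)%:R * tnth x i < (cell (2 ^ m).-1 x i).+1%:R.
Proof.
move=> cx; have := cell_itv (2 ^ m).-1 i cx; move: (nat_of_ord _) => z.
by rewrite ler_pdivrMr ?ltr0n// ltr_pdivlMr ?ltr0n// dyadic_pred_succ mulrC.
Qed.

(** The bin at resolution 2^m containing a given bin at resolution 2^m'. *)
Definition coarsen m m' (A : {ffun 'I_d -> 'I_(2 ^ m').-1.+1}) :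
    {ffun 'I_d -> 'I_(2 ^ m).-1.+1} :=
  [ffun i => inord (A i %/ 2 ^ (m' - m))].

Lemma truncn_divn (y : R) c : (0 < c)%N -> 0 <= y ->
  Num.truncn y = (Num.truncn (c%:R * y) %/ c)%N.
Proof.
move=> c0 y0; have c0' : 0 < c%:R :> R by rewrite ltr0n.
have /andP[h1 h2] : (Num.truncn (c%:R * y))%:R <= c%:R * y < (Num.truncn (c%:R * y)).+1%:R.
  by rewrite truncn_itv// mulr_ge0// ltW.
set t := Num.truncn (c%:R * y) in h1 h2 *; apply: truncn_def; apply/andP; split.
  rewrite -(ler_pM2l c0') (le_trans _ h1)// -natrM ler_nat mulnC; exact: leq_divM.
rewrite -(ltr_pM2l c0') (lt_le_trans h2)// -natrM ler_nat mulnC.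
by rewrite ltn_ceil.
Qed.

Lemma cell_val_coarsen m m' (x : d.-tuple R) i : (m <= m')%N -> cube x ->
  cell (2 ^ m).-1 x i = (cell (2 ^ m').-1 x i %/ 2 ^ (m' - m))%N :> nat.
Proof.
move=> mm' cx; rewrite !cell_val//.
move: (cx i); rewrite in_itv /= => /andP[x0 x1].
rewrite !dyadic_pred_succ (@truncn_divn _ (2 ^ (m' - m)))//.
- by rewrite mulrA -natrM -expnD subnK.
- by rewrite expn_gt0.
- by rewrite mulr_ge0.
Qed.

Lemma cell_coarsen m m' (x : d.-tuple R) : (m <= m')%N -> cube x ->
  cell (2 ^ m).-1 x = coarsen m (cell (2 ^ m').-1 x).
Proof.
move=> mm' cx; apply/ffunP => i; rewrite [RHS]ffunE.
by apply/val_inj; rewrite /= inordK -cell_val_coarsen.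
Qed.

Definition dyadic_set m (S : set {ffun 'I_d -> 'I_(2 ^ m).-1.+1}) : set (d.-tuple R) :=
  cell (2 ^ m).-1 @^-1` S.

Lemma dyadic_set_refine m m' (S : set {ffun 'I_d -> 'I_(2 ^ m).-1.+1}) x :
  (m <= m')%N -> cube x ->
  dyadic_set S x <-> dyadic_set (@coarsen m m' @^-1` S) x.
Proof. by move=> mm' cx; rewrite /dyadic_set /= -cell_coarsen. Qed.

Definition disagree (A B : set (d.-tuple R)) : set (d.-tuple R) :=
  cube `&` ((A `\` B) `|` (B `\` A)).

Lemma measurable_disagree A B : measurable A -> measurable B ->
  measurable (disagree A B).
Proof.
move=> mA mB; apply: measurableI; first exact: measurable_cube.
by apply: measurableU; exact: measurableD.
Qed.

(** Approximation in measure, inside of the cube, by unions of dyadic bins. The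
sets with this property form a sigma-algebra. *)
Definition dyadic_approximable (A : set (d.-tuple R)) :=
  measurable A /\ forall e : R, 0 < e -> exists m (S : set {ffun 'I_d -> 'I_(2 ^ m).-1.+1}),
    (mu (disagree A (dyadic_set S)) <= e%:E)%E.

Lemma measurable_dyadic_set m (S : set {ffun 'I_d -> 'I_(2 ^ m).-1.+1}) :
  measurable (dyadic_set S).
Proof. exact: measurable_cell. Qed.

Lemma dyadic_approximable_exact A m (S : set {ffun 'I_d -> 'I_(2 ^ m).-1.+1}) :
  measurable A -> (forall x, cube x -> A x <-> dyadic_set S x) ->
  dyadic_approximable A.
Proof.
move=> mA AS; split=> // e e0; exists m, S.
rewrite (_ : disagree _ _ = set0) ?measure0 ?lee_fin ?ltW//.
by apply/seteqP; split => // x [cx] [[h1 h2]|[h1 h2]]; have := AS x cx; tauto.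
Qed.

Lemma dyadic_approximableC A : dyadic_approximable A -> dyadic_approximable (~` A).
Proof.
move=> [mA hA]; split=> [|e e0]; first exact: measurableC.
have [m [S hS]] := hA e e0; exists m, (~` S); apply: le_trans hS.
rewrite (_ : disagree (~` A) _ = disagree A (dyadic_set S))//.
rewrite /disagree /dyadic_set preimage_setC !setDE !setCK.
by congr (_ `&` _); rewrite setUC [X in X `|` _]setIC [X in _ `|` X]setIC.
Qed.

Lemma disagreeU A B S T :
  disagree (A `|` B) (S `|` T) `<=` disagree A S `|` disagree B T.
Proof.
move=> x [cx h]; have [hA|hA] := pselect (A x); have [hS|hS] := pselect (S x);
have [hB|hB] := pselect (B x); have [hT|hT] := pselect (T x);
rewrite /disagree /=; case: h => -[] /=; tauto.
Qed.

Lemma dyadic_approximableU A B : dyadic_approximable A -> dyadic_approximable B ->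
  dyadic_approximable (A `|` B).
Proof.
move=> [mA hA] [mB hB]; split=> [|e e0]; first exact: measurableU.
have e2 : 0 < e / 2 by rewrite divr_gt0.
have [m [S hS]] := hA _ e2; have [m' [S' hS']] := hB _ e2.
pose M := maxn m m'.
exists M, ((@coarsen m M @^-1` S) `|` (@coarsen m' M @^-1` S')).
set D := dyadic_set _.
have -> : disagree (A `|` B) D = disagree (A `|` B) (dyadic_set S `|` dyadic_set S').
  apply/seteqP; rewrite /disagree; split=> x [cx h]; split=> //;
  have h1 := dyadic_set_refine S (leq_maxl m m') cx;
  have h2 := dyadic_set_refine S' (leq_maxr m m') cx;
  have h3 : D x <-> (dyadic_set S `|` dyadic_set S') x by
    rewrite /D /setU /= h1 h2.
  - by move: h; rewrite /setU /setD /= in h3 *; tauto.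
  - by move: h; rewrite /setU /setD /= in h3 *; tauto.
have mS := measurable_dyadic_set S; have mS' := measurable_dyadic_set S'.
rewrite (splitr e) EFinD; apply: le_trans (leeD hS hS').
apply: le_trans (measureU2 mu (measurable_disagree mA mS) (measurable_disagree mB mS')).
apply: le_measure; rewrite ?inE; [..|exact: disagreeU].
- by apply: measurable_disagree; exact: measurableU.
- by apply: measurableU; exact: measurable_disagree.
Qed.

(** The countable union is approximated in measure by a finite one, by continuity
from above of the measure. *)
Lemma dyadic_approximable_bigcup (A : (set (d.-tuple R))^nat) :
  (forall n, dyadic_approximable (A n)) -> dyadic_approximable (\bigcup_n A n).
Proof.
move=> hA; pose U n := \big[setU/set0]_(i < n) A i.
have hU n : dyadic_approximable (U n).
  rewrite /U; elim/big_ind : _ => //.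
    by apply: (@dyadic_approximable_exact _ 0 set0) => // x _; split.
  exact: dyadic_approximableU.
have mA : measurable (\bigcup_n A n) by apply: bigcupT_measurable => n; exact: (hA n).1.
split=> // e e0; have e2 : 0 < e / 2 by rewrite divr_gt0.
(* what the first n sets miss, a decreasing sequence with empty intersection *)
pose F n := cube `&` (\bigcup_n A n `\` U n).
have mF n : measurable (F n).
  apply: measurableI; first exact: measurable_cube.
  by apply: measurableD => //; exact: (hU n).1.
have capF : \bigcap_n F n = set0.
  apply/seteqP; split => // x h; have [_ [[n _ An] _]] := h 0%N I.
  have [_ [_]] := h n.+1 I; apply.
  by rewrite /U big_ord_recr /=; right.
have cF : mu \o F @ \oo --> 0%E.
  rewrite -(@measure0 _ _ _ mu) -capF; apply: nonincreasing_cvg_mu => //.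
  - apply: (@le_lt_trans _ _ (mu cube)); last by rewrite measure_cube ltry.
    by apply: le_measure; rewrite ?inE//; [exact: measurable_cube|move=> x []].
  - exact: bigcapT_measurable.
  - apply/nonincreasing_seqP => n; apply/subsetPset => x [cx [h1 h2]]; split=> //.
    by split=> // h3; apply: h2; rewrite /U big_ord_recr /=; left.
have [_ /cvgr_lt/(_ _ e2)[N _ /(_ N (leqnn N)) /= hN]] := (fine_cvgP _ _).1 cF.
have Ffin : mu (F N) \is a fin_num.
  rewrite ge0_fin_numE//; apply: (@le_lt_trans _ _ (mu cube)); last by rewrite measure_cube ltry.
  by apply: le_measure; rewrite ?inE//; [exact: measurable_cube|move=> x []].
have [m [S hS]] := (hU N).2 _ e2; exists m, S.
have mS := measurable_dyadic_set S.
have mD := measurable_disagree (hU N).1 mS.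
rewrite (splitr e) EFinD; apply: (@le_trans _ _ (mu (F N) + mu (disagree (U N) (dyadic_set S)))%E).
  apply: le_trans (measureU2 mu (mF N) mD).
  apply: le_measure; rewrite ?inE; first exact: measurable_disagree.
    exact: measurableU.
  have UA : U N `<=` \bigcup_n A n by exact: bigsetU_bigcup.
  move=> x [cx h]; rewrite /F /disagree /=.
  have [hx|hx] := pselect (U N x); last first.
    case: h => -[h1 h2]; first by left.
    by right; split => //; right; split.
  case: h => -[h1 h2]; first by right; split => //; left; split.
  by exfalso; apply: h2; exact: UA.
by apply: leeD => //; rewrite -(fineK Ffin) lee_fin ltW.
Qed.

(** Half-spaces {x_i < a} generate the sigma-algebra. Each of them is, in the
cube, the increasing union over m of the bins of resolution 2^m that it
contains. *)
Lemma measurable_dyadic_approximable (A : set (d.-tuple R)) :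
  measurable A -> dyadic_approximable A.
Proof.
apply: smallest_sub A; first split.
- by apply: (@dyadic_approximable_exact _ 0 set0) => // x _; split.
- by move=> A hA; rewrite setTD; exact: dyadic_approximableC.
- exact: dyadic_approximable_bigcup.
move=> A; rewrite -bigcup_seq => -[i _ [B mB <-]]; rewrite setTI.
have {mB} : <<s @RGenInftyO.G R >> B.
  rewrite [X in X B](_ : _ = (@RGenInftyO.G R).-sigma.-measurable)//.
  by rewrite -RGenInftyO.measurableE.
move: B; apply: smallest_sub; first split.
- rewrite /= preimage_set0.
  by apply: (@dyadic_approximable_exact _ 0 set0) => // x _; split.
- by move=> B hB; rewrite setTD /= preimage_setC; exact: dyadic_approximableC.
- by move=> B hB; rewrite /= preimage_bigcup; exact: dyadic_approximable_bigcup.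
move=> _ [a ->] /=.
pose S m := [set A : {ffun 'I_d -> 'I_(2 ^ m).-1.+1} | (A i).+1%:R <= (2 ^ m)%:R * a].
have mray (c : R) : measurable [set x : d.-tuple R | tnth x i < c].
  have := measurable_tnth i measurableT (measurable_itv `]-oo, c[).
  rewrite setTI; congr measurable; apply/seteqP; split => x /=; rewrite in_itv//=.
pose G m := [set x : d.-tuple R | tnth x i < a] `&` (~` cube `|` dyadic_set (S m)).
have -> : (tnth (T:=R))^~ i @^-1` `]-oo, a[%classic = \bigcup_m G m.
  apply/seteqP; split => x /=; rewrite in_itv/=; last by case=> m _ [].
  move=> xa; have [cx|ncx] := pselect (cube x); last by exists 0%N => //; split => //; left.
  have ax : 0 < a - tnth x i by rewrite subr_gt0.
(* 1 / 2^m is at most a - x_i, so that the bin of x stays below a *)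
  pose m := Num.truncn ((a - tnth x i)^-1); exists m => //; split => //; right.
  rewrite /dyadic_set /S /=.
  have c0 : 0 < (2 ^ m)%:R :> R by rewrite ltr0n expn_gt0.
  have h2 : 1 <= (2 ^ m)%:R * (a - tnth x i).
    rewrite -ler_pdivrMr// mul1r (le_trans (ltW (truncnS_gt _)))// ler_nat.
    exact: ltn_expl.
  have /andP[+ _] := dyadic_cell_itv m i cx.
  by rewrite -natr1; move: h2; rewrite mulrBr; lra.
apply: dyadic_approximable_bigcup => m.
apply: (@dyadic_approximable_exact _ m (S m)).
  apply: measurableI => //; apply: measurableU; last exact: measurable_dyadic_set.
  by apply: measurableC; exact: measurable_cube.
move=> x cx; rewrite /G /=; split; first by case=> _ [].
move=> h; split; last by right.
move: h; rewrite /dyadic_set /S /=.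
have /andP[_] := dyadic_cell_itv m i cx.
have c0 : 0 < (2 ^ m)%:R :> R by rewrite ltr0n expn_gt0.
move=> h1 h2.
by have := lt_le_trans h1 h2; rewrite ltr_pM2l.
Qed.

Definition step_approximable (f : d.-tuple R -> R) := forall e : R, 0 < e ->
  exists m (c : {ffun 'I_d -> 'I_(2 ^ m).-1.+1} -> R),
    L1_norm (f \- (c \o cell (2 ^ m).-1)) <= e.

Lemma step_approximable_indic (A : set (d.-tuple R)) :
  measurable A -> step_approximable \1_A.
Proof.
move=> mA e e0; have [_ /(_ e e0)[m [S hS]]] := measurable_dyadic_approximable mA.
exists m, \1_S; have mS := measurable_dyadic_set S.
have mD := measurable_disagree mA mS.
rewrite -lee_fin; apply: le_trans hS.
rewrite /L1_norm /Rintegral.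
have -> : (\int[mu]_(x in cube) `|(\1_A \- (\1_S \o cell (2 ^ m).-1)) x|%:E)%E
    = mu (disagree A (dyadic_set S)).
  rewrite (eq_integral (fun x => (\1_(disagree A (dyadic_set S)) x)%:E)).
    rewrite integral_indic//; last exact: measurable_cube.
    by congr (mu _); apply/seteqP; split => [x []//|x h]; split => //; case: h.
  move=> x; rewrite inE => cx; congr EFin; rewrite /= !indicE.
  have E1 : (x \in disagree A (dyadic_set S)) = (x \in A) (+) (cell (2 ^ m).-1 x \in S).
    apply/idP/idP; rewrite /disagree /dyadic_set.
      rewrite inE => -[_ [[/= h1 h2]|[/= h1 h2]]].
        by rewrite mem_set// memNset.
      by rewrite addbC mem_set// memNset.
    move=> h; rewrite inE; split => //=; move: h.
    have [h1|h1] := pselect (A x); have [h2|h2] := pselect (S (cell (2 ^ m).-1 x));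
    rewrite ?(mem_set h1) ?(memNset h1) ?(mem_set h2) ?(memNset h2)//= => _; tauto.
  rewrite E1; case: (x \in A); case: (_ \in S) => /=;
  by rewrite ?subrr ?subr0 ?sub0r ?normrN ?normr0 ?normr1.
rewrite fineK// ge0_fin_numE//; apply: (@le_lt_trans _ _ (mu cube)); last by rewrite measure_cube ltry.
by apply: le_measure; rewrite ?inE//; [exact: measurable_cube|move=> x []].
Qed.

End dyadic.

Import HBSimple.

Section step_density.
Variables (R : realType) (d : nat).
Local Notation mu := (@lebesgue_tuple R d).
Local Notation cube := (@cube R d).
Local Notation integrable f := (mu.-integrable cube (EFin \o f)).

Lemma eq_L1_norm (f g : d.-tuple R -> R) :
  (forall x, cube x -> f x = g x) -> L1_norm f = L1_norm g.
Proof. by move=> fg; apply: eq_Rintegral => x; rewrite inE => /fg ->. Qed.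

Lemma step_approximable0 : step_approximable (fun _ : d.-tuple R => 0).
Proof.
move=> e e0; exists 0%N, (fun=> 0); rewrite (@eq_L1_norm _ (fun=> 0)).
  by rewrite /L1_norm /Rintegral normr0 integral0 ltW.
by move=> x _ /=; rewrite subrr.
Qed.

Lemma step_approximableD (f g : d.-tuple R -> R) : integrable f -> integrable g ->
  step_approximable f -> step_approximable g -> step_approximable (f \+ g).
Proof.
move=> intf intg hf hg e e0; have e2 : 0 < e / 2 by rewrite divr_gt0.
have [m1 [c1 h1]] := hf _ e2; have [m2 [c2 h2]] := hg _ e2.
pose M := maxn m1 m2; exists M, ((c1 \o @coarsen d m1 M) \+ (c2 \o @coarsen d m2 M)).
rewrite (@eq_L1_norm _
  ((f \- (c1 \o cell (2 ^ m1).-1)) \+ (g \- (c2 \o cell (2 ^ m2).-1)))).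
  rewrite (splitr e); apply: le_trans (lerD h1 h2); apply: L1_normD;
  by apply: integrableB_cube => //; exact: integrable_cell.
move=> x cx /=; rewrite (cell_coarsen (leq_maxl m1 m2) cx).
by rewrite (cell_coarsen (leq_maxr m1 m2) cx) /M; ring.
Qed.

Lemma step_approximableZ (r : R) (f : d.-tuple R -> R) : integrable f ->
  step_approximable f -> step_approximable (fun x => r * f x).
Proof.
move=> intf hf e e0.
have [->|r0] := eqVneq r 0.
  by rewrite (_ : (fun x => 0 * f x) = fun=> 0);
    [exact: step_approximable0|apply/funext => x; rewrite mul0r].
have rr : 0 < `|r| by rewrite normr_gt0.
have [m [c h]] := hf (e / `|r|) (divr_gt0 e0 rr).
exists m, (fun A => r * c A).
move: h; rewrite ler_pdivlMr// => h; apply: le_trans h.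
rewrite mulrC -RintegralZl//; last 2 first.
- exact: measurable_cube.
- apply: integrable_norm; apply: (integrableB_cube intf); exact: integrable_cell.
rewrite le_eqVlt; apply/orP; left; apply/eqP.
by apply: eq_Rintegral => x _ /=; rewrite -mulrBr normrM.
Qed.

Lemma step_approximable_sfun (f : {sfun d.-tuple R >-> R}) :
  step_approximable (fun x : d.-tuple R => f x).
Proof.
pose n := #|` fset_set (range f)|.
have indint (A : set (d.-tuple R)) : measurable A -> integrable \1_A.
  move=> mA; apply: measurable_bounded_integrable.
  - exact: measurable_cube.
  - by rewrite /= measure_cube ltry.
  - exact: measurable_indic.
  - exists 1; split; first by rewrite num_real.
    move=> M M1 x _ /=; rewrite indicE; case: (_ \in _); rewrite ?normr1 ?normr0 ltW//.
    exact: lt_trans M1.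
pose F (i : 'I_n) x : R := (fset_set (range f))`_i * \1_(f @^-1` [set (fset_set (range f))`_i]) x.
have mfi (i : 'I_n) : measurable (f @^-1` [set (fset_set (range f))`_i]) by [].
have intF (i : 'I_n) : integrable (F i).
  have := integrableZl (@measurable_cube R d) (fset_set (range f))`_i (indint _ (mfi i)).
  by apply: eq_integrable => //; exact: measurable_cube.
have fE : (fun x : d.-tuple R => f x) = (fun x => \sum_(i < n) F i x).
  by apply/funext => x; rewrite [LHS]fimfunEord.
rewrite fE.
suff H (r : seq 'I_n) : integrable (fun x => \sum_(i <- r) F i x) /\
    step_approximable (fun x => \sum_(i <- r) F i x) by case: (H (index_enum _)).
elim: r => [|i r [ir sr]].
  rewrite (_ : (fun x => _) = fun=> 0); last by apply/funext => x; rewrite big_nil.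
  by split; [exact: integrable0|exact: step_approximable0].
rewrite (_ : (fun x => _) = F i \+ (fun x => \sum_(i <- r) F i x)); last first.
  by apply/funext => x; rewrite big_cons.
split; first exact: integrableD_cube.
apply: step_approximableD => //; apply: step_approximableZ; first exact: indint.
exact: step_approximable_indic.
Qed.

Lemma step_approximable_integrable (f : d.-tuple R -> R) :
  integrable f -> step_approximable f.
Proof.
move=> intf e e0; have e2 : 0 < e / 2 by rewrite divr_gt0.
have [g [intg _ fg]] := approximation_sfun_integrable (@measurable_cube R d) intf.
have [_ /cvgr_lt/(_ _ e2)[N _ /(_ N (leqnn N)) /= hN]] := (fine_cvgP _ _).1 fg.
have [m [c h]] := step_approximable_sfun (g N) e2.
exists m, c; rewrite (splitr e).
apply: le_trans (L1_norm_triangle (g := fun x : d.-tuple R => g N x) intf (intg N) (integrable_cell c)) _.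
by apply: lerD => //; exact: ltW.
Qed.

(** Replacing the step function by its positive part only brings it closer to a
nonnegative function. *)
Lemma step_density (p : d.-tuple R -> R) (e : R) : density p -> 0 < e ->
  exists m (c : {ffun 'I_d -> 'I_(2 ^ m).-1.+1} -> R),
    (forall A, 0 <= c A) /\ L1_norm ((c \o cell (2 ^ m).-1) \- p) <= e.
Proof.
move=> pd e0; have intp := density_integrable pd; have [mp p0 _] := pd.
have [m [c h]] := step_approximable_integrable intp e0.
exists m, (fun A => Num.max (c A) 0); split.
  by move=> A; rewrite le_max lexx orbT.
rewrite L1_normBC; apply: le_trans h.
apply: le_L1_norm.
- apply: integrableB_cube => //.
  exact: (integrable_cell (fun A => Num.max (c A) 0)).
- by apply: integrable_norm; apply: integrableB_cube => //; exact: integrable_cell.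
move=> x cx /=; have := p0 x cx; set y := c _ => px; rewrite maxEle.
by case: (leP y 0) => y0 //; rewrite subr0 !ger0_norm//; lra.
Qed.

End step_density.

(** * Histograms *)

Section histograms.
Variables (R : realType) (d b : nat).
Local Notation mu := (@lebesgue_tuple R d).
Local Notation cube := (@cube R d).
Local Notation Omega := {ffun 'I_d -> 'I_b.+1}.
Local Notation integrable f := (mu.-integrable cube (EFin \o f)).

Definition hist (w : Omega -> R) (x : d.-tuple R) : R :=
  \sum_A w A * bin_density A x.

Lemma hist_cell w x : cube x -> hist w x = b.+1%:R ^+ d * w (cell b x).
Proof.
move=> cx; rewrite /hist (bigD1 (cell b x))//= bin_densityE// eqxx mulr1.
rewrite big1 ?addr0 1?mulrC// => A /negbTE h; rewrite bin_densityE// h.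
by rewrite !mulr0.
Qed.

Lemma histogram_hist w : (forall A, 0 <= w A) -> \sum_A w A = 1 ->
  histogram b.+1 (hist w).
Proof.
move=> w0 w1; exists #|Omega|, (w \o enum_val), (fun i => bin_density (enum_val i)).
split.
- by split=> [i|] /=; [exact: w0|rewrite -w1 [RHS]big_enum_val].
- by move=> i; exists (enum_val i).
- apply/funext => x; rewrite fct_sumE /hist.
  by rewrite [LHS]big_enum_val.
Qed.

Lemma integrable_hist w : integrable (hist w).
Proof.
have h := integrable_cell (fun A : Omega => b.+1%:R ^+ d * w A).
apply: eq_integrable h; first exact: measurable_cube.
by move=> x; rewrite inE => cx /=; rewrite hist_cell.
Qed.

Lemma L1_norm_hist w : L1_norm (hist w) = \sum_A `|w A|.
Proof.
rewrite (L1_norm_cell (c := fun A => b.+1%:R ^+ d * w A)); last exact: hist_cell.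
apply: eq_bigr => A _; rewrite normrM ger0_norm ?exprn_ge0// mulrAC mulfV ?mul1r//.
Qed.

Lemma L1_norm_histB v w : L1_norm (hist v \- hist w) = \sum_A `|v A - w A|.
Proof.
rewrite -(L1_norm_hist (fun A => v A - w A)); congr L1_norm; apply/funext => x /=.
by rewrite /hist -sumrB; apply: eq_bigr => A _; rewrite mulrBl.
Qed.

Lemma L1_norm_hist_density_le2 w (p : d.-tuple R -> R) :
  (forall A, 0 <= w A) -> \sum_A w A = 1 -> density p ->
  L1_norm (hist w \- p) <= 2.
Proof.
move=> w0 w1 pd; have intp := density_integrable pd.
apply: (@le_trans _ _ (L1_norm (hist w) + L1_norm p)).
  rewrite -RintegralD; [|exact: measurable_cube|apply: integrable_norm; exact: integrable_hist|exact: integrable_norm].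
  apply: le_L1_norm; [by apply: integrableB_cube => //; exact: integrable_hist| |].
    apply: (integrableD_cube (f := Num.norm \o hist w) (g := Num.norm \o p)); apply: integrable_norm => //.
    exact: integrable_hist.
  by move=> x _; exact: ler_normB.
rewrite (L1_norm_density pd) L1_norm_hist (eq_bigr w) ?w1// => A _.
by rewrite ger0_norm.
Qed.

Lemma hist_mass_le w (p : d.-tuple R -> R) (E : pred Omega) : density p ->
  `|\sum_(A | E A) w A - \int[mu]_(x in cube `&` (cell b @^-1` [set A | E A])) p x|
  <= L1_norm (hist w \- p).
Proof.
move=> pd; have intp := density_integrable pd.
set C := cube `&` _.
have mC : measurable C.
  by apply: measurableI; [exact: measurable_cube|exact: measurable_cell].
have CS : C `<=` cube by move=> x [].
have inth := integrable_hist w.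
have sub f : integrable f -> mu.-integrable C (EFin \o f).
  by apply: integrableS => //; exact: measurable_cube.
have -> : \sum_(A | E A) w A = \int[mu]_(x in C) hist w x.
  rewrite (@eq_Rintegral _ _ _ _ _ (fun x => b.+1%:R ^+ d * w (cell b x))); last first.
    by move=> x; rewrite inE => -[cx _]; rewrite hist_cell.
  rewrite (Rintegral_cell (fun A => b.+1%:R ^+ d * w A) E).
  apply: eq_bigr => A _; rewrite mulrAC mulfV ?mul1r//.
rewrite -RintegralB//; [|exact: sub..].
have intB := integrableB_cube inth intp.
apply: le_trans (le_normr_Rintegral mC (sub _ intB)) _.
rewrite /L1_norm /Rintegral fine_le//.
- apply: integrable_fin_num => //; apply: (sub (Num.norm \o (hist w \- p))).
  exact: integrable_norm.
- by apply: integrable_fin_num; [exact: measurable_cube|exact: integrable_norm].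
- apply: ge0_subset_integral => //; first exact: measurable_cube.
  apply/measurable_EFinP; apply: measurableT_comp => //.
  by case/integrableP: intB => /measurable_EFinP.
Qed.

(** Normalising moves the function by the difference between its mass and 1,
which is at most e since p has mass 1. If the mass vanishes, then e >= 1 and
the trivial bound 2 applies. *)
Lemma L1_norm_normalize (t : Omega -> R) (p : d.-tuple R -> R) (e : R) :
  (forall A, 0 <= t A) -> density p -> L1_norm ((t \o cell b) \- p) <= e ->
  L1_norm (hist (normalize t) \- p) <= 2 * e.
Proof.
move=> t0 pd te; have intp := density_integrable pd.
have intt := integrable_cell t.
have b0 : 0 < b.+1%:R ^+ d :> R by rewrite exprn_gt0.
have O0 : (0 < #|Omega|)%N by rewrite card_ffun !card_ord expn_gt0.
have [S0|S0] := eqVneq (\sum_A t A) 0.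
  apply: le_trans (L1_norm_hist_density_le2 _ _ pd) _.
  - by move=> A; exact: normalize_ge0.
  - exact: sum_normalize.
  rewrite -[leLHS]mulr1 ler_pM2l//; apply: le_trans te.
  rewrite -(L1_norm_density pd) le_eqVlt; apply/orP; left; apply/eqP.
  apply: eq_Rintegral => x _ /=.
  by rewrite (psumr_eq0P (fun A _ => t0 A) S0)// sub0r normrN.
set S := \sum_A t A in S0 *; set B := b.+1%:R ^+ d in b0 *.
have Sgt0 : 0 < S by rewrite lt_def S0 sumr_ge0.
have m1 : `|S / B - 1| <= e.
  apply: le_trans te; have [_ _ p1] := pd.
  have -> : 1 = \int[mu]_(x in cube) p x by rewrite /Rintegral p1.
  rewrite /S mulr_suml -Rintegral_cellT -RintegralB//; last exact: measurable_cube.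
  apply: le_normr_Rintegral; first exact: measurable_cube.
  by apply: (integrableB_cube intt intp).
apply: le_trans (L1_norm_triangle (integrable_hist _) intt intp) _.
rewrite mulr_natl mulr2n lerD//.
rewrite (@L1_norm_cell _ _ _ (fun A => (B / S - 1) * t A)); last first.
  move=> x cx /=; rewrite hist_cell// /normalize -/S (negbTE S0) -/B.
  by rewrite mulrBl mul1r mulrA [B / S * _]mulrAC.
rewrite -mulr_suml (eq_bigr (fun A => `|B / S - 1| * t A)); last first.
  by move=> A _; rewrite normrM (ger0_norm (t0 A)).
rewrite -mulr_sumr -/S -/B -mulrA; apply: le_trans m1.
have SB : 0 < S / B by rewrite divr_gt0.
rewrite -{1}(gtr0_norm SB) -normrM mulrBl mul1r distrC.
by rewrite [B / S * _]mulrA divfK ?gt_eqF// mulfV ?gt_eqF.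
Qed.

End histograms.

(** * Approximation by candidates *)

Section bias.
Variables (R : realType) (d : nat).
Hypothesis d0 : (0 < d)%N.
Local Notation mu := (@lebesgue_tuple R d).
Local Notation cube := (@cube R d).
Local Notation integrable f := (mu.-integrable cube (EFin \o f)).

Definition weight b k (th : tensor_param d b k) := normalize (tensor R th).

Lemma weight_ge0 b k (th : tensor_param d b k) A : 0 <= weight th A.
Proof. by apply: normalize_ge0 => ?; exact: tensor_ge0. Qed.

Lemma sum_weight b k (th : tensor_param d b k) : \sum_A weight th A = 1.
Proof. by apply: sum_normalize; rewrite card_ffun !card_ord expn_gt0. Qed.

Lemma approx_weight b k (I : finType) (g : I -> 'I_d -> 'I_b.+1 -> R) (M e : R)
    (p : d.-tuple R -> R) :
  (#|I| <= k)%N -> 1 <= M -> M <= b.+1%:R -> (forall i j a, 0 <= g i j a <= M) ->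
  density p ->
  L1_norm ((fun x => \sum_i \prod_j g i j (cell b x j)) \- p) <= e ->
  exists th : tensor_param d b k,
    L1_norm (hist (weight th) \- p) <= 2 * (k%:R * (d%:R * M ^+ d) / b.+1%:R + e).
Proof.
move=> Ik M1 Mb hg pd he; have intp := density_integrable pd.
have [th Hth] := approx_tensor d0 Ik M1 Mb hg; exists th.
apply: L1_norm_normalize => //; first exact: tensor_ge0.
have int1 := integrable_cell (tensor R th).
have int2 := integrable_cell (fun A : {ffun 'I_d -> 'I_b.+1} => \sum_i \prod_j g i j (A j)).
apply: le_trans (L1_norm_triangle int1 int2 intp) _; apply: lerD => //.
set C := k%:R * _ / _ in Hth *.
have -> : C = \int[mu]_(x in cube) C.
  rewrite Rintegral_cst; last exact: measurable_cube.
  rewrite -[LHS]mulr1; congr (_ * _).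
  exact: (esym (congr1 fine (measure_cube R d))).
apply: le_L1_norm.
- exact: integrableB_cube.
- exact: (integrable_cell (fun=> C)).
- by move=> x cx /=; rewrite distrC.
Qed.

(** A coefficient is distributed evenly over the d factors of a product. *)
Lemma root_mulrn (w : R) : 0 <= w -> (w `^ d%:R^-1) ^+ d = w.
Proof.
move=> w0; rewrite -powR_mulrn ?powR_ge0// -powRrM mulVf ?powRr1//.
by rewrite pnatr_eq0 -lt0n.
Qed.

(** A dyadic step function close to p has one term per bin A at its resolution,
with factors c(A)^(1/d) times the indicators of the sides of A; these
indicators are still constant on the bins of all finer dyadic resolutions. *)
Lemma universal_candidate (p : d.-tuple R -> R) (e : R) : density p -> 0 < e ->
  exists m0 k0 (M : R), 1 <= M /\ forall l k, (m0 <= l)%N -> (k0 <= k)%N ->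
  M <= (2 ^ l)%:R ->
  exists th : tensor_param d (2 ^ l).-1 k,
    L1_norm (hist (weight th) \- p) <= 2 * (k%:R * (d%:R * M ^+ d) / (2 ^ l)%:R + e).
Proof.
move=> pd e0; have [m0 [c [c0 hc]]] := step_density pd e0.
pose I : finType := {ffun 'I_d -> 'I_(2 ^ m0).-1.+1}.
pose r (A : I) : R := c A `^ d%:R^-1.
pose M := 1 + \sum_A r A.
have r0 A : 0 <= r A by exact: powR_ge0.
have M1 : 1 <= M by rewrite lerDl sumr_ge0.
exists m0, #|I|, M; split=> // l k ml Ik Ml.
pose g (A : I) (j : 'I_d) (a : 'I_(2 ^ l).-1.+1) : R :=
  if (a %/ 2 ^ (l - m0))%N == A j then r A else 0.
have hg A j a : 0 <= g A j a <= M.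
  rewrite /g; case: ifP => _; last by rewrite lexx (le_trans _ M1).
  rewrite r0/= (le_trans _ (_ : \sum_A r A <= M)) ?lerDr//.
  by rewrite (bigD1 A)//= lerDl sumr_ge0.
have Ml' : M <= (2 ^ l).-1.+1%:R by rewrite dyadic_pred_succ.
have := @approx_weight _ k I g M e p Ik M1 Ml' hg pd.
rewrite [X in _ / X%:R](dyadic_pred_succ l); apply.
apply: le_trans hc; rewrite le_eqVlt; apply/orP; left; apply/eqP.
apply: eq_L1_norm => x cx /=; congr (_ - _).
have E : \prod_(j < d) g (cell (2 ^ m0).-1 x) j (cell (2 ^ l).-1 x j) =
    c (cell (2 ^ m0).-1 x).
  transitivity (\prod_(j < d) r (cell (2 ^ m0).-1 x)).
    by apply: eq_bigr => j _; rewrite /g (cell_val_coarsen j ml cx) eqxx.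
  by rewrite prodr_const card_ord root_mulrn.
rewrite (bigD1 (cell (2 ^ m0).-1 x : I))//= E big1 ?addr0// => A hA.
apply/eqP; rewrite prodf_seq_eq0 //=; apply/hasP.
have /existsP[j hj] : [exists j, A j != cell (2 ^ m0).-1 x j].
  apply: contraR hA; rewrite negb_exists => /forallP h.
  by apply/eqP/ffunP => j; have := h j; rewrite negbK => /eqP.
exists j; first exact: mem_index_enum.
have hj' : (nat_of_ord (cell (2 ^ m0).-1 x j) == A j) = false.
  by rewrite eq_sym; exact: negbTE hj.
by rewrite /g -(cell_val_coarsen j ml cx) hj'.
Qed.

(** The factors are the functions w_i^(1/d) f_ij read at the left ends of the
bins. The bound M also dominates their Lipschitz constants. *)
Lemma multiview_grid_approx (p : d.-tuple R -> R) : multiview_density p ->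
  exists k (M : R), 1 <= M /\ forall b, exists g : 'I_k -> 'I_d -> 'I_b.+1 -> R,
   (forall i j a, 0 <= g i j a <= M) /\
   forall x, cube x -> `|\sum_i \prod_j g i j (cell b x j) - p x|
     <= k%:R * (d%:R * M ^+ d) / b.+1%:R * M.
Proof.
move=> [k [w [L [f [k0 [w0 w1] L0 hf hp]]]]].
pose r i : R := w i `^ d%:R^-1.
have r0 i : 0 <= r i by exact: powR_ge0.
have fL i j x y : x \in `[0, 1] -> y \in `[0, 1] ->
    `|f i j x - f i j y| <= L * `|x - y|.
  by case: (hf i j) => hL _ _ hx hy; apply: (hL (x, y)).
have f0 i j x : x \in `[0, 1] -> 0 <= f i j x by case: (hf i j) => _ h _; exact: h.
have I0 : (0 : R) \in `[0, 1] by rewrite in_itv/= lexx ler01.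
have fb i j x : x \in `[0, 1] -> f i j x <= f i j 0 + L.
  move=> hx; rewrite -lerBlDl; apply: le_trans (ler_norm _) _.
  apply: le_trans (fL i j x 0 hx I0) _; rewrite subr0.
  move: hx; rewrite in_itv/= => /andP[x0 x1].
  by rewrite ger0_norm// ler_piMr.
pose M := 1 + \sum_i \sum_j r i * (f i j 0 + L).
have t0 i j : 0 <= r i * (f i j 0 + L) by rewrite mulr_ge0// addr_ge0// f0.
have M1 : 1 <= M by rewrite lerDl; do 2 apply: sumr_ge0 => ? _.
have tM i j : r i * (f i j 0 + L) <= M.
  rewrite (le_trans _ (_ : \sum_i \sum_j r i * (f i j 0 + L) <= M)) ?lerDr//.
  rewrite (bigD1 i)//= (bigD1 j)//= -addrA lerDl addr_ge0 ?sumr_ge0// => i' _.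
  exact: sumr_ge0.
exists k, M; split=> // b.
have b0 : 0 < b.+1%:R :> R by rewrite ltr0n.
have grid (a : 'I_b.+1) : a%:R / b.+1%:R \in `[0 : R, 1].
  by rewrite in_itv/= divr_ge0//= ler_pdivrMr// mul1r ler_nat ltnW.
have rfM i j x : x \in `[0, 1] -> 0 <= r i * f i j x <= M.
  move=> hx; rewrite mulr_ge0 ?f0//= (le_trans _ (tM i j))// ler_wpM2l//.
  exact: fb.
exists (fun i j a => r i * f i j (a%:R / b.+1%:R)); split=> [i j a|x cx].
  exact: rfM.
have cx' j : tnth x j \in `[0, 1].
  by have := cx j; rewrite !in_itv/= => /andP[-> /ltW].
have -> : p x = \sum_i \prod_(j < d) (r i * f i j (tnth x j)).
  rewrite hp//; apply: eq_bigr => i _.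
  by rewrite big_split /= prodr_const card_ord root_mulrn.
rewrite -sumrB; apply: le_trans (ler_norm_sum _ _ _) _.
rewrite -!mulrA mulr_natl -[k in leRHS]card_ord -sumr_const; apply: ler_sum => i _.
rewrite mulrA; apply: prodr_diff_le => // j; [exact: rfM|exact: rfM|].
rewrite -mulrBr normrM ger0_norm// [leRHS]mulrC ler_pdivlMr// -mulrA.
apply: le_trans (tM i j); rewrite ler_wpM2l//.
apply: (@le_trans _ _ L); last by rewrite lerDr f0.
have /andP[c1 c2] := cell_itv b j cx.
rewrite -ler_pdivlMr//; apply: le_trans (fL i j _ _ (grid _) (cx' j)) _.
rewrite ler_wpM2l// ler0_norm ?subr_le0// opprB lerBlDr -[X in X + _]mul1r -mulrDl.
by rewrite addrC natr1 ltW.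
Qed.

End bias.

(** * The bins of a sample *)

Section finite_valued.
Context (R : realType) (disp : measure_display) (T : measurableType disp).
Variables (F : finType) (J : T -> F).
Hypothesis mJ : forall j, measurable (J @^-1` [set j]).

Lemma preimage_finType (Q : pred F) :
  [set t | Q (J t)] = \bigcup_(j in [set` enum Q]) (J @^-1` [set j]).
Proof.
apply/seteqP; split=> [t /= h|t [j /=]]; first by exists (J t); rewrite //= mem_enum.
by rewrite mem_enum => Qj ->.
Qed.

Lemma measurable_finType (Q : pred F) : measurable [set t | Q (J t)].
Proof. by rewrite preimage_finType; apply: fin_bigcup_measurable. Qed.

Lemma measure_finType (P : probability T R) (Q : pred F) :
  P [set t | Q (J t)] = (\sum_(j | Q j) P (J @^-1` [set j]))%E.
Proof.
rewrite preimage_finType measure_fin_bigcup//.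
- by rewrite -fsbig_seq ?enum_uniq// big_enum.
- by move=> i j _ _ [t /= [<- <-]].
Qed.

End finite_valued.

Section sample_cells.
Context (R : realType) (disp : measure_display) (T : measurableType disp).
Variables (P : probability T R) (d : nat) (X : nat -> {RV P >-> d.-tuple R}).
Variables (p : d.-tuple R -> R) (b n : nat).
Hypotheses (pd : density p) (Xp : iid_sample X p).
Local Notation Omega := {ffun 'I_d -> 'I_b.+1}.
Local Notation mu := (@lebesgue_tuple R d).
Local Notation cube := (@cube R d).

Definition cell_prob (A : Omega) : R :=
  \int[mu]_(x in cube `&` (cell b @^-1` [set A])) p x.

Definition cells (s : n.-tuple (d.-tuple R)) : {ffun 'I_n -> Omega} :=
  [ffun i => cell b (tnth s i)].

Let integrable_sub (C : set (d.-tuple R)) : measurable C ->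
  mu.-integrable (cube `&` C) (EFin \o p).
Proof.
move=> mC; apply: integrableS (density_integrable pd) => //.
- exact: measurable_cube.
- by apply: measurableI => //; exact: measurable_cube.
Qed.

Lemma cell_prob_ge0 A : 0 <= cell_prob A.
Proof. by apply: Rintegral_ge0 => x [cx _]; case: pd => _ + _; apply. Qed.

Lemma sum_cell_prob (E : pred Omega) :
  \sum_(A | E A) cell_prob A =
  \int[mu]_(x in cube `&` (cell b @^-1` [set A | E A])) p x.
Proof.
have mcell A : measurable (cube `&` (cell b @^-1` [set A])).
  by apply: measurableI; [exact: measurable_cube|exact: measurable_cell].
rewrite [in RHS]/Rintegral.
have -> : cube `&` cell b @^-1` [set A | E A] =
    \big[setU/set0]_(A <- enum E) (cube `&` (cell b @^-1` [set A])).
  rewrite -bigcup_seq; apply/seteqP; split=> [x [cx xE]|x [A /=]].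
    by exists (cell b x) => //=; rewrite mem_enum.
  by rewrite mem_enum => EA [cx /= ->]; split.
rewrite integral_bigsetU_EFin//=.
- rewrite big_enum /= /cell_prob.
  rewrite (eq_bigr (fun A => (\int[mu]_(x in cube `&` (cell b @^-1` [set A])) p x)%:E)).
    by rewrite sumEFin.
  move=> A _; rewrite /Rintegral fineK//.
  by apply: integrable_fin_num => //; apply: integrable_sub; exact: measurable_cell.
- exact: enum_uniq.
- by move=> A B _ _ [x] [[_ /= <-] [_ <-]].
- apply: (@measurable_funS _ _ _ _ cube); first exact: measurable_cube.
    by rewrite -bigcup_seq => x [A _ []].
  by case: pd => mp _ _; exact/measurable_EFinP.
Qed.

Lemma sum_cell_prob1 : \sum_A cell_prob A = 1.
Proof.
have [_ _ p1] := pd.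
rewrite (sum_cell_prob xpredT) (_ : _ `&` _ = cube) /Rintegral ?p1//.
by apply/seteqP; split=> // x [].
Qed.

Lemma probability_cell i (A : Omega) :
  P (X i @^-1` (cell b @^-1` [set A])) = (cell_prob A)%:E.
Proof.
have mc := measurable_cell [set A] : measurable (cell b @^-1` [set A] : set (d.-tuple R)).
have := Xp.2 i _ mc; rewrite /distribution /pushforward => ->.
by rewrite /cell_prob /Rintegral fineK//;
  apply: integrable_fin_num;
  [apply: measurableI => //; exact: measurable_cube|exact: integrable_sub].
Qed.

Definition sample_cells (t : T) : {ffun 'I_n -> Omega} := cells [tuple X i t | i < n].

Lemma measurable_cells (j : {ffun 'I_n -> Omega}) : measurable (cells @^-1` [set j]).
Proof.
have -> : cells @^-1` [set j] =
    \bigcap_(i in setT) ((fun s => tnth s i) @^-1` (cell b @^-1` [set j i])).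
  apply/seteqP; split=> [s /= <- i _ /=|s /= h]; first by rewrite ffunE.
  by apply/ffunP => i; rewrite ffunE; exact: (h i I).
apply: fin_bigcap_measurable => [|i _]; first exact: finite_finset.
rewrite -[X in measurable X]setTI; apply: measurable_tnth => //.
exact: measurable_cell.
Qed.

(** The form required by mutual independence: an intersection over a finite set
of indices in nat, of preimages by the variables. The quantifier over the
ordinals i' converts the index. *)
Lemma sample_cells_preimage j : sample_cells @^-1` [set j] =
  \bigcap_(i in [set` [fset i | i in iota 0 n]%fset])
    X i @^-1` (cell b @^-1` [set A | forall i' : 'I_n, i' = i :> nat -> A = j i']).
Proof.
apply/seteqP; split=> [t /= <- i _ i' <-|t /= h].
  by rewrite ffunE tnth_mktuple.
apply/ffunP => i; rewrite ffunE tnth_mktuple.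
by apply: (h i) => //=; rewrite !inE /= mem_iota add0n ltn_ord.
Qed.

Lemma measurable_sample_cells j : measurable (sample_cells @^-1` [set j]).
Proof.
rewrite sample_cells_preimage; apply: fin_bigcap_measurable => // i _.
rewrite -[X in measurable X]setTI; apply: measurable_funPT => //.
exact: measurable_cell.
Qed.

Lemma probability_sample_cells j :
  P (sample_cells @^-1` [set j]) = (\prod_i cell_prob (j i))%:E.
Proof.
rewrite sample_cells_preimage.
rewrite (Xp.1 _ (fun i => cell b @^-1` [set A | forall i' : 'I_n, i' = i :> nat -> A = j i'])).
  rewrite (perm_big (iota 0 n)); last first.
    apply: uniq_perm; rewrite ?fset_uniq ?iota_uniq// => i.
    by rewrite !inE.
  rewrite (_ : iota 0 n = index_iota 0 n); last by rewrite /index_iota subn0.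
  rewrite big_mkord -prodEFin; apply: eq_bigr => i _.
  rewrite -(probability_cell i); congr (P (_ @^-1` _)).
  apply/seteqP; split=> x /= h; first exact: h.
  by move=> i' /val_inj ->.
by move=> i; exact: measurable_cell.
Qed.

Lemma probability_sample_event (Q : pred {ffun 'I_n -> Omega}) :
  P [set t | Q (sample_cells t)] = (\sum_(j | Q j) \prod_i cell_prob (j i))%:E.
Proof.
rewrite measure_finType -?sumEFin; last exact: measurable_sample_cells.
by apply: eq_bigr => j _; rewrite probability_sample_cells.
Qed.

End sample_cells.

(** * The estimator and its deviations *)

Section estimator.
Variables (R : realType) (d b k n : nat).
Local Notation Theta := (tensor_param d b k).
Local Notation Omega := {ffun 'I_d -> 'I_b.+1}.

Definition select (j : {ffun 'I_n -> Omega}) : Theta :=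
  min_distance (fun th : Theta => weight R th) [ffun=> ord0] (empirical R j).

Definition estimator (s : n.-tuple (d.-tuple R)) : d.-tuple R -> R :=
  hist (weight R (select (cells b s))).

Lemma histogram_estimatorP : histogram_estimator b.+1 estimator.
Proof.
split=> [s|x]; first by apply: histogram_hist; [exact: weight_ge0|exact: sum_weight].
move=> _ Y mY; rewrite setTI.
have -> : estimator^~ x @^-1` Y =
    [set s | hist (weight R (select (cells b s))) x \in Y].
  by apply/seteqP; split=> s; rewrite /= inE.
apply: (measurable_finType _ (fun j => hist (weight R (select j)) x \in Y)).
exact: measurable_cells.
Qed.

Context (disp : measure_display) (T : measurableType disp).
Variables (P : probability T R) (X : nat -> {RV P >-> d.-tuple R}).
Variables (p : d.-tuple R -> R).
Hypotheses (pd : density p) (Xp : iid_sample X p).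

(** Decomposition of the error: the constant 5 comes from 4 in the comparison of
the selected candidate with th, and 1 from the distance of th to p. *)
Lemma estimator_error (j : {ffun 'I_n -> Omega}) (th : Theta) (a t : R) :
  L1_norm (hist (weight R th) \- p) <= a ->
  (forall pr : Theta * Theta, `|\sum_(A | weight R pr.2 A < weight R pr.1 A)
      (empirical R j A - cell_prob p A)| <= t) ->
  L1_norm (hist (weight R (select j)) \- p) <= 4 * t + 5 * a.
Proof.
move=> ha ht; have intp := density_integrable pd.
apply: le_trans (L1_norm_triangle (integrable_hist _) (integrable_hist (weight R th)) intp) _.
rewrite (_ : 4 * t + 5 * a = 4 * t + 4 * a + a); last by ring.
apply: lerD => //; rewrite L1_norm_histB.
apply: (@min_distanceP R _ _ (fun th : Theta => weight R th) [ffun=> ord0] th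
  (empirical R j) (@cell_prob R d p b) t a) => //.
- exact: sum_weight.
- move=> E; rewrite sumrB (sum_cell_prob pd); apply: le_trans ha.
  exact: hist_mass_le.
Qed.

(** Union bound over the pairs of candidates. *)
Lemma estimator_tail (th : Theta) (a t z : R) : (0 < n)%N -> 0 < t ->
  L1_norm (hist (weight R th) \- p) <= a -> 4 * t + 5 * a <= z ->
  (P [set w | (z < L1_norm (estimator [tuple X i w | i < n] \- p))%R] <=
   ((#|Theta| * #|Theta|)%:R * (2 * expR (- (n%:R * t ^+ 2 / 8))))%:E)%E.
Proof.
move=> n0 t0 ha hz.
pose Q (j : {ffun 'I_n -> Omega}) := z < L1_norm (hist (weight R (select j)) \- p).
have -> : [set w | z < L1_norm (estimator [tuple X i w | i < n] \- p)] =
    [set w | Q (sample_cells X b n w)] by [].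
rewrite (probability_sample_event pd Xp) lee_fin.
pose D (pr : Theta * Theta) (j : {ffun 'I_n -> Omega}) :=
  t < `|\sum_(A | weight R pr.2 A < weight R pr.1 A) (empirical R j A - cell_prob p A)|.
pose F (j : {ffun 'I_n -> Omega}) := \prod_i cell_prob p (j i).
have F0 j : 0 <= F j by apply: prodr_ge0 => i _; exact: cell_prob_ge0.
apply: (@le_trans _ _ (\sum_pr \sum_(j | D pr j) F j)).
  rewrite (exchange_big_dep xpredT)//= [leLHS]big_mkcond /=; apply: ler_sum => j _.
  case: ifPn => Qj; last exact: sumr_ge0.
  have /existsP[pr hpr] : [exists pr, D pr j].
    apply: contraLR Qj; rewrite negb_exists => /forallP h.
    rewrite /Q -leNgt; apply: le_trans hz; apply: estimator_error ha _ => pr.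
    by have := h pr; rewrite /D -leNgt.
  by rewrite (bigD1 pr)//= lerDl sumr_ge0.
rewrite -card_prod -[X in _ <= X%:R * _]/(#|{: Theta * Theta}|).
rewrite mulr_natl -sumr_const; apply: ler_sum => pr _.
apply: (hoeffding (@cell_prob_ge0 _ _ _ _ pd) (sum_cell_prob1 _ pd)
  (fun A => weight R pr.2 A < weight R pr.1 A)) => //.
Qed.

End estimator.

(** * Choice of the resolution and of the rank *)

Section asymptotics.
Variable R : realType.

Definition candidate_rank (n : nat) := trunc_log 2 n.

(** There are 2 ^ resolution n bins per dimension; this number lies between
n^(1/3) / 2 and n^(1/3). *)
Definition resolution (n : nat) := (trunc_log 2 n %/ 3)%N.

Local Notation lam n := (ln n%:R : R).
Local Notation root n := (n%:R `^ (3%:R^-1) : R).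

Lemma ln2_ge_half : 2^-1 <= ln 2 :> R.
Proof.
rewrite -ler_expR lnK ?posrE//; apply: le_trans (expR_le_quadratic (lexx _)) _.
by rewrite expr2; lra.
Qed.

Variable n : nat.
Hypothesis n2 : (2 <= n)%N.

Let n0 : 0 < n%:R :> R.
Proof. by rewrite ltr0n (leq_trans _ n2). Qed.

Lemma lam_ge_half : 2^-1 <= lam n.
Proof. by apply: le_trans ln2_ge_half _; rewrite ler_ln ?posrE// ler_nat. Qed.

Lemma root_gt0 : 0 < root n.
Proof. exact: powR_gt0. Qed.

Lemma root_cube : root n ^+ 3 = n%:R.
Proof. by rewrite -powR_mulrn ?powR_ge0// -powRrM mulVf// powRr1// ltW. Qed.

Lemma root_ge1 : 1 <= root n.
Proof.
rewrite -(@ler_pXn2r _ 3)// ?nnegrE ?ler01 ?(ltW root_gt0)//.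
by rewrite expr1n root_cube ler1n (leq_trans _ n2).
Qed.

Lemma resolution_le_root : (2 ^ resolution n)%:R <= root n.
Proof.
rewrite -(@ler_pXn2r _ 3)// ?nnegrE ?(ltW root_gt0)// root_cube.
rewrite -natrX ler_nat -expnM; 
apply: leq_trans (trunc_logP (isT : 1 < 2)%N (ltnW n2)).
by rewrite leq_exp2l// leq_divM.
Qed.

Lemma root_lt_resolution : root n < 2 * (2 ^ resolution n)%:R.
Proof.
rewrite -(@ltr_pXn2r _ 3)// ?nnegrE ?(ltW root_gt0)// root_cube.
rewrite -natrM -natrX ltr_nat -expnS -expnM.
apply: leq_trans (trunc_log_ltn n (isT : 1 < 2)%N) _.
by rewrite leq_exp2l// ltn_ceil.
Qed.

Lemma candidate_rank_ln : (candidate_rank n)%:R * ln 2 <= lam n.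
Proof.
rewrite mulr_natl -lnXn// ler_ln ?posrE ?exprn_gt0// -natrX ler_nat.
exact: trunc_logP (ltnW n2).
Qed.

Lemma candidate_rank_le : (candidate_rank n)%:R <= 2 * lam n.
Proof.
rewrite -(ler_pM2r (_ : 0 < 2^-1 :> R))// mulrAC mulfV// mul1r.
by apply: le_trans candidate_rank_ln; rewrite ler_wpM2l// ln2_ge_half.
Qed.

Lemma candidate_rank_ge1 : (1 <= candidate_rank n)%N.
Proof. by rewrite /candidate_rank trunc_log_gt0. Qed.

(** The logarithm of the number of pairs of candidates is of order
log^2 n * n^(1/3), the order of n t^2 for t = n^(-1/3) log n. *)
Lemma card_param_le d : (#|tensor_param d (2 ^ resolution n).-1 (candidate_rank n)| *
    #|tensor_param d (2 ^ resolution n).-1 (candidate_rank n)|)%:R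
  <= expR (8 * d%:R * lam n ^+ 2 * root n).
Proof.
rewrite card_tensor_param dyadic_pred_succ -expnD addnn.
set m := resolution n; set l := candidate_rank n.
have hm : ((2 ^ m * 2 ^ m).+1 <= 2 ^ (2 * l))%N.
  apply: (@leq_trans (2 ^ l.+1)); last first.
    by rewrite leq_exp2l// mul2n -addnn -addn1 leq_add2l candidate_rank_ge1.
  rewrite -expnD expnS mul2n -addnn -addn1 leq_add ?expn_gt0//.
  rewrite leq_exp2l//; apply: leq_trans (leq_divM l 3).
  by rewrite addnn -muln2 leq_mul.
apply: (@le_trans _ _ ((2 ^ (2 * l * (l * d * 2 ^ m).*2))%N%:R)).
  rewrite ler_nat (expnM 2 (2 * l)%N); case: (_.*2)%N => [|e]; first by rewrite !expn0.
  by rewrite leq_exp2r.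
rewrite natrX -[2 in leLHS]lnK ?posrE// -expRM_natl ler_expR.
have -> : (2 * l * (l * d * 2 ^ m).*2)%N%:R = 4 * d%:R * l%:R * (l%:R) * (2 ^ m)%:R :> R.
  by rewrite -muln2 !natrM; ring.
have hr := resolution_le_root; have h2l := candidate_rank_le; have hl := candidate_rank_ln.
apply: (@le_trans _ _ (4 * d%:R * (l%:R * ln 2) * l%:R * (2 ^ m)%:R)).
  by rewrite le_eqVlt; apply/orP; left; apply/eqP; ring.
rewrite (_ : 8 * d%:R * lam n ^+ 2 * root n = 4 * d%:R * lam n * (2 * lam n) * root n); last by ring.
have l2 : 0 <= ln 2 :> R by apply: le_trans ln2_ge_half; rewrite invr_ge0.
by rewrite !ler_pM ?mulr_ge0.
Qed.

(** From n^(1/6) = exp(ln n / 6) >= ln n / 6. *)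
Lemma lam_root_le : lam n / root n <= 36 / lam n.
Proof.
have l0 : 0 < lam n by apply: lt_le_trans lam_ge_half; rewrite invr_gt0.
rewrite ler_pdivrMr ?root_gt0// mulrAC ler_pdivlMr//.
have -> : root n = expR (lam n / 6) ^+ 2.
  by rewrite -expRM_natl /powR gt_eqF//; congr expR; field.
have h : lam n / 6 <= expR (lam n / 6) by apply: le_trans (expR_ge1Dx _); rewrite lerDr.
have h6 : 0 <= lam n / 6 by rewrite divr_ge0// ltW.
rewrite (_ : lam n * lam n = 36 * (lam n / 6) ^+ 2); last by field.
by rewrite ler_pM2l// lerXn2r// nnegrE// expR_ge0.
Qed.

End asymptotics.

(** * Limits *)

Section convergence.
Variable R : realType.

Lemma cvg_ereal0 (I : Type) (F : set_system I) (f : I -> \bar R) : Filter F ->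
  (forall i, 0 <= f i)%E ->
  (forall e : R, 0 < e -> \forall i \near F, (f i <= e%:E)%E) ->
  f @ F --> 0%E.
Proof.
move=> FF f0 fe; apply/fine_cvgP; split.
  apply: filterS (fe 1 ltr01) => i h.
  by rewrite ge0_fin_numE//; exact: (le_lt_trans h (ltry _)).
apply/cvgrPdist_le => e e0; apply: filterS (fe e e0) => i h.
rewrite sub0r normrN ger0_norm ?fine_ge0//= -lee_fin fineK//.
by rewrite ge0_fin_numE//; exact: (le_lt_trans h (ltry _)).
Qed.

Lemma two_expR_small (e : R) : 0 < e -> exists2 K : R, 0 <= K & 2 * expR (- (K / 4)) <= e.
Proof.
move=> e0; exists (8 / e); first by rewrite divr_ge0// ltW.
rewrite (_ : 8 / e / 4 = 2 / e); last by field; rewrite gt_eqF.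
have h : 2 / e <= expR (2 / e) by apply: le_trans (expR_ge1Dx _); rewrite lerDr.
rewrite expRN ler_pdivrMr ?expR_gt0//.
by rewrite mulrC -ler_pdivrMr.
Qed.

Lemma ln_large (c : R) : exists N, forall n, (N <= n)%N -> c <= ln n%:R.
Proof.
exists (Num.truncn (expR c)).+1 => n hn.
have h : expR c <= n%:R by rewrite (le_trans (ltW (truncnS_gt _)))// ler_nat.
by rewrite -[c]expRK ler_ln ?posrE ?expR_gt0// (lt_le_trans (expR_gt0 c)).
Qed.

Lemma resolution_large (l m : nat) (c : R) : exists N, forall n, (N <= n)%N ->
  [/\ (2 <= n)%N, (l <= candidate_rank n)%N, (m <= resolution n)%N &
      c <= (2 ^ resolution n)%:R].
Proof.
pose s := (Num.truncn c).+1; pose L := (l + 3 * (m + s)).+1.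
exists (2 ^ L)%N => n hn.
have n2 : (2 <= n)%N by apply: leq_trans hn; rewrite -{1}(expn1 2) leq_exp2l.
have hL : (L <= candidate_rank n)%N by exact: trunc_log_max.
have hm : (m + s <= resolution n)%N.
  by rewrite /resolution leq_divRL//; move: hL; rewrite /candidate_rank /L; lia.
split=> //.
- by move: hL; rewrite /L; lia.
- by lia.
- apply: ltW; apply: lt_le_trans (truncnS_gt c) _; rewrite ler_nat -/s.
  apply: leq_trans (ltnW (ltn_expl _ (isT : 1 < 2)%N)); apply: leq_trans hm.
  exact: leq_addl.
Qed.

End convergence.

(** * Consistency and rate *)

Section rates.
Variables (R : realType) (d : nat).
Local Notation lam n := (ln n%:R : R).
Local Notation root n := (n%:R `^ (3%:R^-1) : R).
Local Notation V n := (@estimator R d (2 ^ resolution n).-1 (candidate_rank n) n).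
Local Notation Theta n := (tensor_param d (2 ^ resolution n).-1 (candidate_rank n)).

Context (disp : measure_display) (T : measurableType disp).
Variables (P : probability T R) (X : nat -> {RV P >-> d.-tuple R}).
Variables (p : d.-tuple R -> R).
Hypotheses (pd : density p) (Xp : iid_sample X p).

(** Deviations at the scale n^(-1/3) log n: the exponent of Hoeffding's bound is
M^2 / 8 times log^2 n * n^(1/3), which beats the logarithm of the number of
pairs of candidates as soon as M is large. *)
Lemma estimator_deviation n (th : Theta n) (K M a z : R) : (2 <= n)%N -> 0 <= K -> 0 < M ->
  8 * (8 * d%:R + K) <= M ^+ 2 ->
  L1_norm (hist (weight R th) \- p) <= a ->
  4 * (M * lam n / root n) + 5 * a <= z ->
  (P [set w | (z < L1_norm (V n [tuple X i w | i < n] \- p))%R] <=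
   (2 * expR (- (K / 4)))%:E)%E.
Proof.
move=> n2 K0 M0 MK ha hz.
have l0 : 0 < lam n by apply: lt_le_trans (lam_ge_half R n2); rewrite invr_gt0.
have r0 := root_gt0 R n2; have rn := root_cube R n; have r1 := root_ge1 R n2.
have t0 : 0 < M * lam n / root n by rewrite divr_gt0// mulr_gt0.
apply: le_trans (estimator_tail pd Xp (ltnW n2) t0 ha hz) _.
rewrite lee_fin mulrCA ler_pM2l//.
apply: (@le_trans _ _ (expR (8 * d%:R * lam n ^+ 2 * root n) *
   expR (- (n%:R * (M * lam n / root n) ^+ 2 / 8)))).
  by rewrite ler_wpM2r ?expR_ge0//; exact: card_param_le.
rewrite -expRD ler_expR.
have -> : n%:R * (M * lam n / root n) ^+ 2 / 8 = M ^+ 2 / 8 * (lam n ^+ 2 * root n).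
  rewrite -[X in X * _ ^+ 2 / 8 = _]rn; move: (root n) r0 => r r0; field.
  exact: lt0r_neq0.
have h1 : 4^-1 <= lam n ^+ 2 * root n.
  have h := lam_ge_half R n2.
  apply: (@le_trans _ _ (lam n ^+ 2)); last by rewrite ler_peMr// sqr_ge0.
  by rewrite expr2; nra.
set u := lam n ^+ 2 * root n in h1 *.
have -> : 8 * d%:R * lam n ^+ 2 * root n = 8 * d%:R * u by rewrite /u mulrA.
nra.
Qed.

(** The best candidate has error at most e / 20 plus a multiple of
n^(-1/3) log n, and the deviations have the same order, so that both are
eventually below e. *)
Lemma estimator_consistent : (0 < d)%N ->
  cvg_in_probability P (fun n w => L1_norm (V n [tuple X i w | i < n] \- p)) 0.
Proof.
move=> d0 e e0; apply: cvg_ereal0 => // del del0.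
have [K K0 hK] := two_expR_small del0.
(* any M with M ^ 2 >= 8 (8 d + K) would do *)
pose M := 8 * (8 * d%:R + K + 1).
have dK : 0 <= 8 * d%:R + K by rewrite addr_ge0// mulr_ge0.
have M0 : 0 < M by rewrite /M; lra.
have MK : 8 * (8 * d%:R + K) <= M ^+ 2 by rewrite /M expr2; nra.
have e40 : 0 < e / 40 by rewrite divr_gt0.
have [m0 [k0 [M1 [M11 hbias]]]] := universal_candidate d0 pd e40.
pose c := d%:R * M1 ^+ d.
have c0 : 0 <= c by rewrite mulr_ge0// exprn_ge0// (le_trans ler01).
have [N1 hN1] := resolution_large k0 m0 M1.
have [N2 hN2] := ln_large ((4 * M + 40 * c) * 36 * 2 / e).
exists (maxn N1 N2) => // n /=; rewrite geq_max => /andP[/hN1[n2 hl hm hM] /hN2 hlam].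
have [th hth] := hbias _ _ hm hl hM.
apply: le_trans (_ : (2 * expR (- (K / 4)))%:E <= _)%E; last by rewrite lee_fin.
rewrite (_ : [set t | _] = [set w | e < L1_norm (V n [tuple X i w | i < n] \- p)]); last first.
  by apply/seteqP; split=> w /=; rewrite subr0 ger0_norm// L1_norm_ge0.
apply: (estimator_deviation n2 K0 M0 MK hth).
have l0 : 0 < lam n by apply: lt_le_trans (lam_ge_half R n2); rewrite invr_gt0.
have r0 := root_gt0 R n2.
have q36 := lam_root_le R n2.
have b0 : 0 < (2 ^ resolution n)%:R :> R by rewrite ltr0n expn_gt0.
set q := lam n / root n in q36.
have kb : (candidate_rank n)%:R * c / (2 ^ resolution n)%:R <= 4 * q * c.
  rewrite ler_pdivrMr// /q.
  have h1 := candidate_rank_le R n2; have h2 := root_lt_resolution R n2.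
  have h3 : 1 <= 2 * (2 ^ resolution n)%:R / root n by rewrite ler_pdivlMr// mul1r ltW.
  rewrite (_ : 4 * (lam n / root n) * c * _ =
    (2 * lam n) * c * (2 * (2 ^ resolution n)%:R / root n)); last by ring.
  apply: (@le_trans _ _ (2 * lam n * c)); first by rewrite ler_wpM2r.
  by rewrite ler_peMr// mulr_ge0// mulr_ge0// ltW.
have qe : (4 * M + 40 * c) * q <= e / 2.
  have cM : 0 <= 4 * M + 40 * c by rewrite addr_ge0// mulr_ge0// ltW.
  apply: le_trans (ler_wpM2l cM q36) _.
  rewrite mulrA ler_pdivrMr//.
  by move: hlam; rewrite ler_pdivrMr//; lra.
rewrite -[M * lam n / _]mulrA -/q -/c; move: kb qe.
set x := _ * c / _; lra.
Qed.


(** The tail bound is uniform in n, and can be made arbitrarily small by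
increasing the constant M. *)
Lemma bounded_root_rate (B : R) :
  (forall n, (2 <= n)%N -> exists th : Theta n,
     L1_norm (hist (weight R th) \- p) <= B * (lam n / root n)) ->
  bounded_in_probability P
    (fun m w => let n := m.+2 in
       L1_norm (V n [tuple X i w | i < n] \- p) * n%:R `^ (3%:R^-1) * ln n%:R `^ (- 1)).
Proof.
move=> hB; apply: cvg_ereal0 => [M|e e0].
  apply: le_ereal_sup_tmp; eexists; first by exists 0%N.
  exact: measure_ge0.
have [K K0 hK] := two_expR_small e0.
(* any M with M ^ 2 >= 8 (8 d + K) would do *)
pose M := 8 * (8 * d%:R + K + 1).
have dK : 0 <= 8 * d%:R + K by rewrite addr_ge0// mulr_ge0.
have M0 : 0 < M by rewrite /M; lra.
have MK : 8 * (8 * d%:R + K) <= M ^+ 2 by rewrite /M expr2; nra.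
exists (4 * M + 5 * B); split; first by rewrite num_real.
move=> z hz; apply: ge_ereal_sup => _ [m _ <-].
set n := m.+2; have n2 : (2 <= n)%N by [].
have l0 : 0 < lam n by apply: lt_le_trans (lam_ge_half R n2); rewrite invr_gt0.
have r0 := root_gt0 R n2.
have [th hth] := hB n n2.
apply: (@le_trans _ _ (2 * expR (- (K / 4)))%:E); last by rewrite lee_fin.
rewrite (_ : [set t | _] =
  [set w | z * (lam n / root n) < L1_norm (V n [tuple X i w | i < n] \- p)]).
  apply: (estimator_deviation n2 K0 M0 MK hth).
  rewrite (_ : _ + _ = (4 * M + 5 * B) * (lam n / root n)); last by ring.
  by rewrite ler_wpM2r ?divr_ge0 ?(ltW r0) ?(ltW l0)// ltW.
apply/seteqP; split=> w /=; rewrite powR_inv1 ?ltW// ger0_norm;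
  rewrite ?mulr_ge0 ?L1_norm_ge0 ?invr_ge0 ?(ltW l0) ?(ltW r0)//.
- by rewrite mulrA ltr_pdivrMr// ltr_pdivlMr.
- by rewrite mulrA ltr_pdivrMr// ltr_pdivlMr.
Qed.

(** For small n, where the rank or the resolution does not suffice, the trivial
bound 2 on the distance is absorbed by the term with N in the constant. *)
Lemma multiview_candidate : (0 < d)%N -> multiview_density p ->
  exists B : R, forall n, (2 <= n)%N -> exists th : Theta n,
     L1_norm (hist (weight R th) \- p) <= B * (lam n / root n).
Proof.
move=> d0 mp; have [k0 [M [M1 hg]]] := multiview_grid_approx d0 mp.
have intp := density_integrable pd.
pose c := d%:R * M ^+ d.
have c0 : 0 <= c by rewrite mulr_ge0// exprn_ge0// (le_trans ler01).
have [N hN] := resolution_large k0 0 M.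
pose C := 8 * c + 8 * (k0%:R * c * M).
have Mge0 : 0 <= M by exact: le_trans M1.
have C0 : 0 <= C by apply: addr_ge0; do !apply: mulr_ge0 => //.
exists (C + 4 * N%:R) => n n2.
have l0 : 0 < lam n by apply: lt_le_trans (lam_ge_half R n2); rewrite invr_gt0.
have lh := lam_ge_half R n2.
have r0 := root_gt0 R n2; have r1 := root_ge1 R n2; have rn := root_cube R n.
have q0 : 0 < lam n / root n by rewrite divr_gt0.
have [/hN[_ hl _ hM]|nN] := leqP N n; last first.
  exists [ffun=> ord0].
  apply: le_trans (L1_norm_hist_density_le2 _ _ pd) _.
  - exact: weight_ge0.
  - exact: sum_weight.
  apply: (@le_trans _ _ (4 * N%:R * (lam n / root n))); last first.
    by rewrite [leRHS]mulrDl lerDr mulr_ge0// ltW.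
  rewrite mulrA ler_pdivlMr//.
  have rN : root n <= N%:R.
    apply: (@le_trans _ _ n%:R); last by rewrite ler_nat ltnW.
    by rewrite -[leRHS]rn exprS ler_peMr ?exprn_ege1// ltW.
  apply: le_trans (ler_wpM2l _ rN) _ => //.
  rewrite -mulrA mulrCA mulrC ler_wpM2l//; lra.
have [g [gM hgp]] := hg (2 ^ resolution n).-1.
have b0 : 0 < (2 ^ resolution n)%:R :> R by rewrite ltr0n expn_gt0.
have hM' : M <= (2 ^ resolution n).-1.+1%:R by rewrite dyadic_pred_succ.
pose e := k0%:R * c / (2 ^ resolution n)%:R * M.
have he : L1_norm ((fun x => \sum_i \prod_j g i j (cell (2 ^ resolution n).-1 x j)) \- p) <= e.
  rewrite (_ : e = \int[@lebesgue_tuple R d]_(x in @cube R d) e); last first.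
    rewrite Rintegral_cst; last exact: measurable_cube.
    rewrite -[LHS]mulr1; congr (_ * _).
    exact: (esym (congr1 fine (measure_cube R d))).
  apply: le_L1_norm.
  - apply: integrableB_cube => //.
    exact: (integrable_cell (fun A : {ffun 'I_d -> 'I_(2 ^ resolution n).-1.+1} =>
      \sum_i \prod_j g i j (A j))).
  - exact: (integrable_cell (b := 0) (fun=> e)).
  - move=> x cx /=; apply: le_trans (hgp x cx) _.
    by rewrite /e /c (dyadic_pred_succ (resolution n)).
have hI : (#|'I_k0| <= candidate_rank n)%N by rewrite card_ord.
have [th hth] := approx_weight d0 hI M1 hM' gM pd he.
exists th; apply: le_trans hth _.
rewrite -/c [X in _ / X%:R](dyadic_pred_succ (resolution n)) /e.
have ib : (2 ^ resolution n)%:R^-1 <= 2 / root n.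
  rewrite ler_pdivlMr// mulrC ler_pdivrMr// ltW//; exact: root_lt_resolution.
have hl2 := candidate_rank_le R n2.
set i := _^-1 in ib *; have i0 : 0 <= i by rewrite invr_ge0 ltW.
have h1 : (candidate_rank n)%:R * c * i <= 2 * lam n * c * (2 / root n).
  by apply: ler_pM => //; [exact: mulr_ge0|exact: ler_wpM2r].
have h2 : k0%:R * c * i * M <= k0%:R * c * (2 * lam n * (2 / root n)) * M.
  apply: ler_wpM2r => //; apply: ler_wpM2l; first exact: mulr_ge0.
  apply: le_trans ib _; apply: ler_peMl; last by lra.
  by rewrite divr_ge0// ltW.
apply: (@le_trans _ _ (C * (lam n / root n))); last first.
  by rewrite [leRHS]mulrDl lerDl !mulr_ge0// ltW.
rewrite (_ : C * (lam n / root n) = 2 * (2 * lam n * c * (2 / root n) +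
   k0%:R * c * (2 * lam n * (2 / root n)) * M)); last by rewrite /C; ring.
by rewrite ler_pM2l// lerD.
Qed.

End rates.

(** The density is the pointwise limit on the cube of step functions, hence
measurable. *)
Lemma multiview_density_density (R : realType) d (p : d.-tuple R -> R) :
  (0 < d)%N -> multiview_density p ->
  (\int[lebesgue_tuple]_(x in @cube R d) (p x)%:E = 1)%E -> density p.
Proof.
move=> d0 mp p1; split=> //.
- have [k0 [M [M1 hg]]] := multiview_grid_approx d0 mp.
  have {}hg b := cid (hg b).
  pose h b (x : d.-tuple R) := \sum_i \prod_j (projT1 (hg b)) i j (cell b x j).
  apply: (@measurable_fun_cvg _ _ _ _ h).
    move=> b; exact: (measurable_fun_cell (fun A : {ffun 'I_d -> 'I_b.+1} =>
      \sum_i \prod_j (projT1 (hg b)) i j (A j))).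
  move=> x cx; apply/cvgrPdist_le => e e0.
  pose C := k0%:R * (d%:R * M ^+ d) * M.
  exists (Num.truncn (C / e)) => // b /= hb.
  have [_ hx] := projT2 (hg b).
  rewrite distrC; apply: le_trans (hx x cx) _.
  rewrite mulrAC -/C ler_pdivrMr ?ltr0n// mulrC -ler_pdivrMr//.
  by rewrite (le_trans (ltW (truncnS_gt _)))// ler_nat.
- case: mp => [k [w [L [f [k0 [w0 w1] L0 hf hp]]]]] x cx; rewrite hp//.
  apply: sumr_ge0 => i _; rewrite mulr_ge0//; apply: prodr_ge0 => j _.
  have [_ + _] := hf i j; apply.
  by have := cx j; rewrite !in_itv/= => /andP[-> /ltW].
Qed.

Lemma has_density_integral1 (R : realType) d (disp : measure_display)
    (T : measurableType disp) (P : probability T R) (X : {RV P >-> d.-tuple R})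
    (p : d.-tuple R -> R) : has_density X p ->
  (\int[lebesgue_tuple]_(x in @cube R d) (p x)%:E = 1)%E.
Proof.
move=> /(_ setT measurableT); rewrite setIT => <-.
by rewrite /distribution /pushforward preimage_setT probability_setT.
Qed.


Theorem mainTheorem9 (R : realType) (d : nat) (d_gt0 : (0 < d)%N) :
  exists (b : nat -> nat)
         (V : forall n : nat, n.-tuple (d.-tuple R) -> d.-tuple R -> R),
  [/\ forall n : nat, (0 < n)%N ->
        (0 < b n)%N /\ histogram_estimator (b n) (V n),
      forall p : d.-tuple R -> R, density p ->
        forall (disp : measure_display) (T : measurableType disp)
               (P : probability T R) (X : nat -> {RV P >-> d.-tuple R}),
        iid_sample X p ->
        cvg_in_probability P
          (fun n t => L1_norm (V n [tuple X i t | i < n] \- p)) 0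
    & forall p : d.-tuple R -> R, multiview_density p ->
        exists2 q : R, 0 <= q &
        forall (disp : measure_display) (T : measurableType disp)
               (P : probability T R) (X : nat -> {RV P >-> d.-tuple R}),
        iid_sample X p ->
        bounded_in_probability P
          (fun m t => let n := m.+2 in
            L1_norm (V n [tuple X i t | i < n] \- p) *
            n%:R `^ (3%:R^-1) * ln n%:R `^ (- q))].
Proof.
exists (fun n => (2 ^ resolution n).-1.+1),
  (fun n => @estimator R d (2 ^ resolution n).-1 (candidate_rank n) n); split.
- by move=> n n0; split=> //; exact: histogram_estimatorP.
- by move=> p pd disp T P X Xp; exact: estimator_consistent.
- move=> p mp; exists 1 => // disp T P X Xp.
  have pd : density p.
    by apply: multiview_density_density => //; exact: (has_density_integral1 (Xp.2 0%N)).
  have [B hB] := multiview_candidate pd d_gt0 mp.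
  exact: (bounded_root_rate pd Xp hB).
Qed.
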